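(* Let $A$ be a finite alphabet, $X\subseteq A^{\mathbb N^+}$ a one-sided subshift, and $f=\sigma|_X$. Assume there are a non-empty compact set $Y\subseteq X$ and a positive integer $N$ such that $f^N(Y)=Y$, $X=\bigcup_{l=0}^{N-1}f^l(Y)$ and $(Y,f^N)$ has the non-uniform specification property. For each $j\ge1$ let $\varphi_j:\mathbb N\to(0,1]$, let $\mathcal Z_j=\{z_j^i\}_{i=0}^\infty\subset X$, and let $S_j=\{s_j^i\}_{i=0}^\infty\subset\mathbb N$ be a sequence of positive integers with $\lim_{i\to\infty}s_j^i=\infty$. Put $\overline\tau:=\sup_{j\ge1}\limsup_{n\to\infty}-\frac{\ln\varphi_j(n)}{n}$, $\underline\tau:=\sup_{j\ge1}\liminf_{n\to\infty}-\frac{\ln\varphi_j(n)}{n}$ and $\mathfrak S_\infty:=\bigcap_{j=1}^\infty\mathfrak S(f,\varphi_j,\mathcal Z_j,S_j)$. If $\bigcap_{j=1}^\infty\mathrm{Ind}'(\mathcal Z_j,S_j,Y)\ne\emptyset$, then $\mathfrak S_\infty$ is non-empty and $$\frac1{1+\overline\tau}h_{top}(f,X)\le h_{top}(f,\mathfrak S_\infty)\le\frac1{1+\underline\tau}h_{top}(f,X),$$ $$\frac1{1+\overline\tau}h_{top}(f,X)\le\dim_H\mathfrak S_\infty\le\frac1{1+\underline\tau}h_{top}(f,X).$$ When $Y=X$, $N=1$ and $S_j=\mathbb N$ for all $j\ge1$, $$h_{top}(f,\mathfrak S_\infty)=\frac1{1+\underline\tau}h_{top}(f,X),\qquad\dim_H\mathfrak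 S_\infty=\frac1{1+\underline\tau}h_{top}(f,X).$$
   Context: $\mathbb N$ is the set of non-negative integers, $\mathbb N^+$ the set of positive integers. $A^{\mathbb N^+}$ is the set of sequences $x_1x_2\cdots$ over $A$ with shift $\sigma(x_1x_2\cdots)=x_2x_3\cdots$ and metric $d(\omega,\gamma)=e^{-\min\{k\in\mathbb N^+:\omega_k\ne\gamma_k\}}$ for $\omega\ne\gamma$, $d(\omega,\omega)=0$. A one-sided subshift is a closed $\sigma$-invariant subset $X\subseteq A^{\mathbb N^+}$. $X$ is assumed to have at least two points. When $\overline\tau$ or $\underline\tau$ equals $+\infty$ the corresponding fraction is read as $0$. Shrinking target set: $\mathfrak S(f,\varphi,\mathcal Z,S):=\{x\in X: d(f^n(x),z_n)<\varphi(n)\text{ for infinitely many }n\in S\}$; for $\mathcal Z_j=\{z_j^i\}_{i\ge0}$ the centre at time $n$ is $z_j^n$. Index sets: for $\mathcal Z=\{z_i\}_{i=0}^\infty\subset X$ and positive integers $S=\{s_i\}_{i=0}^\infty$ with $s_i\to\infty$, $\mathrm{Ind}(\mathcal Z,S,Y)$ is the set of $(I_1,I_2)\in\{0,\dots,N-1\}^2$ such that there are infinitely many $i$ with $z_{s_i}\in f^{I_1}(Y)$ and $N\mid(s_i-I_2)$; $\mathrm{Ind}'(\mathcal Z,S,Y):=\{I_1-I_2:(I_1,I_2)\in\mathrm{Ind}(\mathcal Z,S,Y)\}$. Dynamical ball: $B_n(x,\varepsilon,g)=\{y: d(g^i(x),g^i(y))<\varepsilon,\ 0\le i\le n-1\}$.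 $(W,g)$ has the non-uniform specification property if for every scale $\varepsilon>0$ and every $n\ge1$ there is a positive integer $p(n,\varepsilon)$ with $\limsup_{n\to\infty}\frac1np(n,\varepsilon)=0$ such that for any $x_1,\dots,x_k\in W$, positive integers $n_1,\dots,n_k$ and $p_i\ge p(n_i,\varepsilon)$ there is $z\in W$ with $z\in B_{n_1}(x_1,\varepsilon,g)$ and $g^{n_1+p_1+\cdots+n_{i-1}+p_{i-1}}(z)\in B_{n_i}(x_i,\varepsilon,g)$ for $2\le i\le k$. Bowen topological entropy of a subset $Z\subseteq X$: for $s\ge0$, $m\ge 1$, $\varepsilon>0$ let $\mathcal M^s_{m,\varepsilon}(Z)=\inf\sum_i e^{-sn_i}$ over finite or countable families $\{B_{n_i}(x_i,\varepsilon,f)\}$ covering $Z$ with $x_i\in X$, $n_i\ge m$; $\mathcal M^s_\varepsilon(Z)=\lim_{m\to\infty}\mathcal M^s_{m,\varepsilon}(Z)$; $h_{top}(f,Z,\varepsilon)=\inf\{s:\mathcal M^s_\varepsilon(Z)=0\}$; $h_{top}(f,Z)=\lim_{\varepsilon\to0}h_{top}(f,Z,\varepsilon)$. $\dim_H$ is Hausdorff dimension with respect to $d$. *)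

(* Defs.v *)
From HB Require Import structures.
From mathcomp Require Import all_boot all_order all_algebra.
From mathcomp Require Import all_classical all_reals all_analysis.

Set Implicit Arguments.
Unset Strict Implicit.
Unset Printing Implicit Defensive.

Import Order.TTheory GRing.Theory Num.Theory.
Import numFieldNormedType.Exports.

Local Open Scope classical_set_scope.
Local Open Scope ring_scope.

(* A sequence x_1 x_2 ... is encoded by the function k |-> x_{k+1}. The unused
   parameter R is the field in which the metric takes its values. *)
Definition full_shift (R : realType) (A : finType) : Type := nat -> A.

HB.instance Definition _ (R : realType) (A : finType) :=
  Choice.copy (full_shift R A) (nat -> A).

Section FullShiftMetric.
Variables (R : realType) (A : finType).
Implicit Types x y z : full_shift R A.

(* With indices starting at 0, the first disagreement of the paper's sequences
   is at position [ex_minn h].+1. *)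
Definition seq_dist x y : R :=
  match pselect (exists k : nat, x k != y k) with
  | left h => expR (- (ex_minn h).+1%:R)
  | right _ => 0
  end.

Fact seq_dist_ge0 x y : 0 <= seq_dist x y.
Proof. by rewrite /seq_dist; case: pselect => // h; rewrite expR_ge0. Qed.

Fact seq_distxx x : seq_dist x x = 0.
Proof. by rewrite /seq_dist; case: pselect => // h; exfalso; case: h => k; rewrite eqxx. Qed.

Fact seq_dist_positivity x y : seq_dist x y = 0 -> x = y.
Proof.
rewrite /seq_dist; case: pselect => [h|nh _].
  by move=> /eqP; rewrite expR_eq0.
by apply/funext => k; apply: contrapT => /eqP xy; apply: nh; exists k.
Qed.

Fact seq_dist_sym x y : seq_dist x y = seq_dist y x.
Proof.
rewrite /seq_dist; case: pselect => h; case: pselect => h' //.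
- congr (expR (- _.+1%:R)).
  case: ex_minnP => m xym minm; case: ex_minnP => n yxn minn.
  by apply/eqP; rewrite eqn_leq minm 1?eq_sym// minn 1?eq_sym.
- by case: h' ; case: h => k; rewrite eq_sym => ?; exists k.
- by case: h ; case: h' => k; rewrite eq_sym => ?; exists k.
Qed.

Fact seq_dist_triangle y x z : seq_dist x z <= seq_dist x y + seq_dist y z.
Proof.
have lt_dist u v k : u k != v k -> expR (- k.+1%:R) <= seq_dist u v.
  move=> uvk; rewrite /seq_dist; case: pselect => [h|[]]; last by exists k.
  case: ex_minnP => m _ /(_ _ uvk) mk.
  by rewrite ler_expR lerN2 ler_nat ltnS.
rewrite {1}/seq_dist; case: pselect => [h|_]; last first.
  by rewrite addr_ge0 ?seq_dist_ge0.
case: ex_minnP => m xzm _; have [xym|xym] := eqVneq (x m) (y m).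
  apply: (le_trans (lt_dist y z m _)); first by rewrite -xym.
  by rewrite lerDr seq_dist_ge0.
by apply: (le_trans (lt_dist x y m xym)); rewrite lerDl seq_dist_ge0.
Qed.

HB.instance Definition _ := @isMetric.Build R (full_shift R A) seq_dist
  seq_distxx seq_dist_positivity seq_dist_sym seq_dist_triangle.

Definition left_shift (x : full_shift R A) : full_shift R A := fun k => x k.+1.

Definition is_subshift (X : set (full_shift R A)) : Prop :=
  closed X /\ left_shift @` X `<=` X.

End FullShiftMetric.

Arguments left_shift {R A} x.

Section Dynamics.
Context {R : realType} {T : metricType R}.
Local Open Scope ereal_scope.

(* In this section a dynamical system (W, g) is a subset W of T together with
   g : T -> T, assumed to map W to itself; only g restricted to W matters. *)

Definition dyn_ball (W : set T) (g : T -> T) (n : nat) (x : T) (e : R) : set T :=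
  [set y | W y /\
     forall i, (i < n)%N -> (mdist (iter i g x) (iter i g y) < e)%R].

(* Blocks are numbered from 0, so block i starts at time
   \sum_(j < i) (n_j + p_j). *)
Definition nonuniform_specification (W : set T) (g : T -> T) : Prop :=
  forall e : R, (0 < e)%R -> exists p : nat -> nat,
    [/\ forall n, (0 < n)%N -> (0 < p n)%N,
        limn_esup (fun n => ((p n)%:R / n%:R)%:E : \bar R) = 0 &
        forall (k : nat) (x : nat -> T) (n q : nat -> nat), (0 < k)%N ->
          (forall i, (i < k)%N -> [/\ W (x i), (0 < n i)%N & (p (n i) <= q i)%N]) ->
          exists2 z, W z & forall i, (i < k)%N ->
            dyn_ball W g (n i) (x i) e (iter (\sum_(j < i) (n j + q j))%N g z)].

(* Finite or countable families are indexed by an arbitrary D : set nat. *)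
Definition bowen_premeasure (X : set T) (f : T -> T) (Z : set T)
    (s e : R) (m : nat) : \bar R :=
  ereal_inf [set c | exists (D : set nat) (x : nat -> T) (n : nat -> nat),
    [/\ forall i, D i -> X (x i) /\ (m <= n i)%N,
        Z `<=` \bigcup_(i in D) dyn_ball X f (n i) (x i) e &
        c = \esum_(i in D) (expR (- s * (n i)%:R))%:E]].

Definition bowen_measure (X : set T) (f : T -> T) (Z : set T) (s e : R) : \bar R :=
  limn (bowen_premeasure X f Z s e).

Definition bowen_entropy_at (X : set T) (f : T -> T) (Z : set T) (e : R) : \bar R :=
  ereal_inf [set s%:E | s in
    [set s : R | (0 <= s)%R /\ bowen_measure X f Z s e = 0]].

Definition htop (X : set T) (f : T -> T) (Z : set T) : \bar R :=
  lim (bowen_entropy_at X f Z e @[e --> 0^'+]).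

(* The extra 0 only serves to give the empty set diameter 0. *)
Definition diam (U : set T) : \bar R :=
  ereal_sup (0 |` [set (mdist xy.1 xy.2)%:E | xy in U `*` U]).

Definition hausdorff_premeasure (Z : set T) (s delta : R) : \bar R :=
  ereal_inf [set c | exists (D : set nat) (U : nat -> set T),
    [/\ forall i, D i -> diam (U i) <= delta%:E,
        Z `<=` \bigcup_(i in D) U i &
        c = \esum_(i in D) (diam (U i) `^ s)]].

Definition hausdorff_measure (Z : set T) (s : R) : \bar R :=
  lim (hausdorff_premeasure Z s delta @[delta --> 0^'+]).

Definition hausdorff_dim (Z : set T) : \bar R :=
  ereal_inf [set s%:E | s in [set s : R | (0 <= s)%R /\ hausdorff_measure Z s = 0]].

Definition shrinking_target (X : set T) (f : T -> T) (phi : nat -> R)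
    (z : nat -> T) (S : set nat) : set T :=
  [set x | X x /\
     infinite_set [set n | S n /\ (mdist (iter n f x) (z n) < phi n)%R]].

Definition Ind (f : T -> T) (N : nat) (z : nat -> T) (s : nat -> nat)
    (Y : set T) : set (nat * nat) :=
  [set I | [/\ (I.1 < N)%N, (I.2 < N)%N &
     infinite_set [set i | (iter I.1 f @` Y) (z (s i)) /\
                           (N%:Z %| ((s i)%:Z - I.2%:Z)%R)%Z]]].

Definition Ind' (f : T -> T) (N : nat) (z : nat -> T) (s : nat -> nat)
    (Y : set T) : set int :=
  [set (I.1%:Z - I.2%:Z)%R | I in Ind f N z s Y].

End Dynamics.

Section Rates.
Context {R : realType}.
Local Open Scope ereal_scope.
Implicit Type phi : nat -> nat -> R.

Definition decay_rate (u : nat -> R) : nat -> \bar R :=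
  fun n => (- ln (u n) / n%:R)%:E.

Definition upper_tau phi : \bar R :=
  ereal_sup (range (fun j => limn_esup (decay_rate (phi j)))).

Definition lower_tau phi : \bar R :=
  ereal_sup (range (fun j => limn_einf (decay_rate (phi j)))).

End Rates.

(* Main.v *)
(** Cylinder covers compute both dimensions: the balls of Bowen's definition and
    the sets of small diameter are cylinders up to a bounded shift in length, so
    the entropy and the Hausdorff dimension of a subset of [X] both equal the
    critical exponent [thin_dim] of its covers by long cylinders.  For [X] itself
    this exponent is the exponential growth rate [h] of the number of words.

    Upper bound: a point hitting the [j]-th target at time [n] lies in one of
    about [exp (n h)] cylinders of length [n - ln (phi j n)].

    Lower bound: only finitely many letters matter, so specification glues
    words of [Y] separated by sublinear gaps, and compactness makes the gluing
    infinite.  Visit the targets at very sparse times, and fill the remaining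
    time with freely chosen words of a fixed long length [N * m].  Just after a
    target visited at time [n], about [n (1 + tau)] letters are fixed while the
    number of free choices is that of [n] letters of [X]; a Kraft inequality for
    covers of the space of choices then bounds the exponent from below. The
    condition on the index sets says that a single translate [left_shift^a] of
    [Y] is compatible with infinitely many hitting times of every target. *)

Require Import Defs.
From mathcomp Require Import all_boot all_order all_algebra.
From mathcomp Require Import all_classical all_reals all_analysis.
From mathcomp Require Import zify ring lra.

Set Implicit Arguments.
Unset Strict Implicit.
Unset Printing Implicit Defensive.

Import Order.TTheory GRing.Theory Num.Theory.
Import numFieldNormedType.Exports.

Local Open Scope classical_set_scope.
Local Open Scope ring_scope.
Local Open Scope ereal_scope.

(** * Cylinders and their critical exponent *)

Definition agree (A : Type) (n : nat) (x y : nat -> A) : Prop :=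
  forall i, (i < n)%N -> x i = y i.

Lemma agree_sym (A : Type) n (x y : nat -> A) : agree n x y -> agree n y x.
Proof. by move=> xy i /xy. Qed.

Lemma agree_trans (A : Type) n (y x z : nat -> A) :
  agree n x y -> agree n y z -> agree n x z.
Proof. by move=> xy yz i ni; rewrite xy// yz. Qed.

Lemma agreeW (A : Type) m n (x y : nat -> A) :
  (m <= n)%N -> agree n x y -> agree m x y.
Proof. by move=> mn xy i im; apply: xy; exact: leq_trans mn. Qed.

Lemma iter_left_shiftE (R : realType) (A : finType) n (x : full_shift R A) k :
  iter n left_shift x k = x (n + k)%N.
Proof. by elim: n k => //= n IHn k; rewrite /left_shift IHn addnS. Qed.

Lemma iter_iter (T : Type) (f : T -> T) m n x :
  iter m (iter n f) x = iter (m * n) f x.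
Proof. by elim: m => //= m ->; rewrite -iterD mulSn. Qed.

Lemma agree_iter_left_shift (R : realType) (A : finType) a n
    (x y : full_shift R A) :
  agree (a + n) x y -> agree n (iter a left_shift x) (iter a left_shift y).
Proof. by move=> xy i ni; rewrite !iter_left_shiftE xy// ltn_add2l. Qed.

Lemma mdist_agree (R : realType) (A : finType) (x y : full_shift R A) n :
  agree n x y -> (mdist x y <= expR (- n.+1%:R))%R.
Proof.
move=> xy; rewrite /mdist/= /seq_dist; case: pselect => [h|_]; last exact: expR_ge0.
case: ex_minnP => k xyk _; rewrite ler_expR lerN2 ler_nat ltnS leqNgt.
by apply: contra xyk => kn; rewrite xy.
Qed.

Lemma agree_mdist (R : realType) (A : finType) (x y : full_shift R A) n :
  (mdist x y < expR (- n%:R))%R -> agree n x y.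
Proof.
rewrite /mdist/= /seq_dist; case: pselect => [h|h _ i _]; last first.
  by apply: contrapT => /eqP xyi; apply: h; exists i.
case: ex_minnP => k xyk mink; rewrite ltr_expR ltrN2 ltr_nat ltnS => nk i ni.
apply: contrapT => /eqP xyi.
by have := leq_trans (leq_trans ni nk) (mink _ xyi); rewrite ltnn.
Qed.

Lemma mdist_agree_lt (R : realType) (A : finType) (x y : full_shift R A) n :
  agree n x y -> (mdist x y < expR (- n%:R))%R.
Proof.
by move=> /mdist_agree /le_lt_trans; apply; rewrite ltr_expR ltrN2 ltr_nat.
Qed.

Lemma exists_expRN_le (R : realType) (e : R) :
  (0 < e)%R -> exists n : nat, (expR (- n%:R) <= e)%R.
Proof.
move=> e0; exists (Num.truncn (- ln e)).+1.
by rewrite -ler_ln ?posrE ?expR_gt0// expRK lerNl ltW// truncnS_gt.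
Qed.

Section thin.
Context {R : realType} {A : finType}.
Implicit Types (X Z : set (full_shift R A)) (s : R).

(** The [s]-dimensional cylinder measure of [Z] vanishes. The pieces [U i] are arbitrary and
    agreement is asked only inside [Z], so that Bowen balls and sets of small diameter can serve as
    pieces. *)
Definition thin Z s := forall m (eta : R), (0 < eta)%R ->
  exists (D : set nat) (U : nat -> set (full_shift R A)) (n : nat -> nat),
  [/\ forall i, D i -> (m <= n i)%N /\
        forall x y, Z x -> Z y -> U i x -> U i y -> agree (n i) x y,
      Z `<=` \bigcup_(i in D) U i &
      \esum_(i in D) (expR (- s * (n i)%:R))%:E <= eta%:E].

Lemma esum_cost_ge0 (I : choiceType) (D : set I) (n : I -> nat) s :
  0 <= \esum_(i in D) (expR (- s * (n i)%:R))%:E.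
Proof. by apply: esum_ge0 => i _; rewrite lee_fin expR_ge0. Qed.

Lemma le_esum_subset (I : choiceType) (D D' : set I) (a : I -> \bar R) :
  D `<=` D' -> (forall i, 0 <= a i) -> \esum_(i in D) a i <= \esum_(i in D') a i.
Proof.
move=> DD' a0; rewrite esum_mkcond [leRHS]esum_mkcond; apply: le_esum => i _.
case: ifPn => iD; last by case: ifP.
by rewrite ifT// inE; apply: DD'; rewrite inE in iD.
Qed.

(** Reindexing along [pickle] allows covers indexed by any countable type, such as pairs of a time
    and a word. *)
Lemma thinI (I : countType) Z s :
  (forall m (eta : R), (0 < eta)%R -> exists (D : set I)
     (U : I -> set (full_shift R A)) (n : I -> nat),
   [/\ forall i, D i -> (m <= n i)%N /\
         forall x y, Z x -> Z y -> U i x -> U i y -> agree (n i) x y,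
       Z `<=` \bigcup_(i in D) U i &
       \esum_(i in D) (expR (- s * (n i)%:R))%:E <= eta%:E]) ->
  thin Z s.
Proof.
move=> H m eta /(H m)[D [U [n [DU ZU cost]]]].
pose U' k := if @unpickle I k is Some i then U i else set0.
pose n' k := if @unpickle I k is Some i then n i else 0%N.
exists (pickle @` D), U', n'; split.
- by move=> _ [i Di <-]; rewrite /U' /n' pickleK; exact: DU.
- move=> x /ZU[i Di Uix]; exists (pickle i); first by exists i.
  by rewrite /U' pickleK.
- rewrite esum_image; last by move=> i j _ _; exact: (pcan_inj pickleK).
  by under eq_esum do rewrite /n' pickleK.
Qed.

Lemma thinS Z Z' s : Z `<=` Z' -> thin Z' s -> thin Z s.
Proof.
move=> ZZ' Zs m eta /(Zs m)[D [U [n [DU ZU cost]]]]; exists D, U, n; split => //.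
  by move=> i /DU[mn ag]; split => // x y /ZZ' Zx /ZZ' Zy; exact: ag.
exact: subset_trans ZU.
Qed.

Definition thin_dim Z : \bar R := ereal_inf [set s%:E | s in [set s : R | (0 <= s)%R /\ thin Z s]].

Lemma esumZ_le (I : choiceType) (D : set I) (a : I -> \bar R) (c : R) :
  (0 <= c)%R -> (forall i, 0 <= a i) ->
  \esum_(i in D) (c%:E * a i) <= c%:E * \esum_(i in D) a i.
Proof.
move=> c0 a0; apply: ge_ereal_sup => _ [F [Ff FD] <-].
rewrite -ge0_mule_fsumr//; apply: lee_pmul => //; first exact: fsume_ge0.
by apply: ereal_sup_ubound; exists F.
Qed.

End thin.

Lemma le0_eqe (R : realType) (x : \bar R) :
  0 <= x -> (forall e : R, (0 < e)%R -> x <= e%:E) -> x = 0.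
Proof.
move=> x0 xe; apply/eqP; rewrite eq_le x0 andbT.
by apply/lee_addgt0Pr => e /xe; rewrite add0e.
Qed.

(** * Bowen entropy as a critical exponent *)

Section entropy.
Context {R : realType} {A : finType}.
Variables X Z : set (full_shift R A).
Hypotheses (ZX : Z `<=` X) (Z0 : Z !=set0).
Implicit Types s e : R.

(** Bowen balls need centres: any point of [Z] in [U i] serves, and a piece missing [Z] gets the
    default [z0]. *)
Lemma thin_centers s m eta : thin Z s -> (0 < eta)%R ->
  exists (D : set nat) (x : nat -> full_shift R A) (n : nat -> nat),
  [/\ forall i, Z (x i), forall i, D i -> (m <= n i)%N,
      Z `<=` \bigcup_(i in D) [set y | Z y /\ agree (n i) (x i) y] &
      \esum_(i in D) (expR (- s * (n i)%:R))%:E <= eta%:E].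
Proof.
move=> Zs eta0; have [z0 Zz0] := Z0.
have [D [U [n [DU ZU cost]]]] := Zs m eta eta0.
have /choice[c cP] i : exists x, Z x /\ ((exists y, Z y /\ U i y) -> U i x).
  have [[y [Zy Uy]]|] := pselect (exists y, Z y /\ U i y); first by exists y.
  by exists z0.
exists D, c, n; split => //.
- by move=> i; exact: (cP i).1.
- by move=> i /DU[].
- move=> y Zy; have [i Di Uiy] := ZU y Zy; exists i => //; split => //.
  apply: (DU i Di).2 => //; first exact: (cP i).1.
  by apply: (cP i).2; exists y.
Qed.

Lemma bowen_premeasure_ge0 s e m : 0 <= bowen_premeasure X left_shift Z s e m.
Proof.
by apply: le_ereal_inf_tmp => _ [D [x [n [_ _ ->]]]]; exact: esum_cost_ge0.
Qed.

(** Points sharing [n] letters stay [e]-close for [n - k] steps once e^{-k} <= [e]. Shortening by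
    [k] multiplies the cost by e^{sk}, which a smaller tolerance offsets. *)
Lemma thin_bowen s e : (0 < e)%R -> thin Z s ->
  bowen_measure X left_shift Z s e = 0.
Proof.
move=> e0 Zs; rewrite /bowen_measure.
rewrite (_ : bowen_premeasure _ _ _ _ _ = cst 0) ?lim_cst//; apply/funext => m /=.
have [k ke] := exists_expRN_le e0.
apply: le0_eqe => [|eta eta0]; first exact: bowen_premeasure_ge0.
have [|D [x [n [Zx mn ZU cost]]]] := @thin_centers s (m + k)%N (expR (- s * k%:R) * eta)%R Zs.
  by rewrite mulr_gt0 ?expR_gt0.
apply: (@le_trans _ _ (\esum_(i in D) (expR (- s * (n i - k)%:R))%:E)).
  apply: ereal_inf_lbound; exists D, x, (fun i => n i - k)%N; split => //.
    by move=> i /mn mni; split; [exact: ZX|rewrite leq_subRL ?(leq_trans _ mni) ?leq_addl// addnC].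
  move=> y /ZU[i Di /= [Zy xy]]; exists i => //; split; first exact: ZX.
  move=> j jn; apply: lt_le_trans ke; apply: mdist_agree_lt.
  by apply: agree_iter_left_shift; apply: agreeW xy; have := mn i Di; lia.
rewrite (eq_esum (b := fun i => (expR (s * k%:R))%:E * (expR (- s * (n i)%:R))%:E)); last first.
  move=> i /mn mni; rewrite -EFinM -expRD natrB ?(leq_trans _ mni) ?leq_addl//.
  by congr (expR _)%:E; ring.
apply: le_trans (esumZ_le _ _ _) _; [exact: expR_ge0|by move=> i; rewrite lee_fin expR_ge0|].
apply: le_trans (lee_pmul _ _ (lexx _) cost) _.
- by rewrite lee_fin expR_ge0.
- exact: esum_cost_ge0.
by rewrite -EFinM mulrA -expRD mulNr subrr expR0 mul1r.
Qed.

(** At a scale at most e^{-1} closeness forces equal first letters, so points of a Bowen ball of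
    length [n] share [n] letters. *)
Lemma bowen_thin s e : (0 < e)%R -> (e <= expR (- 1))%R ->
  bowen_measure X left_shift Z s e = 0 -> thin Z s.
Proof.
move=> e0 e1 mu0.
have ndp : nondecreasing_seq (bowen_premeasure X left_shift Z s e).
  apply/nondecreasing_seqP => m; apply: le_ereal_inf_tmp => _ [D [x [n [Dn ZU ->]]]].
  apply: ereal_inf_lbound; exists D, x, n; split => // i /Dn[Xx mn]; split => //; exact: ltnW.
have mu0m m : bowen_premeasure X left_shift Z s e m = 0.
  apply/eqP; rewrite eq_le bowen_premeasure_ge0 andbT -mu0 /bowen_measure.
  rewrite (cvg_lim _ (ereal_nondecreasing_cvgn ndp))//.
  by apply: ereal_sup_ubound; exists m.
move=> m eta eta0.
have : bowen_premeasure X left_shift Z s e m < eta%:E by rewrite mu0m lte_fin.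
move=> /ereal_inf_lt[_ [D [x [n [Dn ZU ->]]]] lteta].
exists D, (fun i => dyn_ball X left_shift (n i) (x i) e), n; split => //.
- move=> i /Dn[_ mn]; split => // y y' _ _ [_ xy] [_ xy'].
  apply: (@agree_trans _ _ (x i)); [apply: agree_sym|]; move=> j jn.
  + by have /(_ 0%N isT) := agree_mdist (n := 1) (lt_le_trans (xy j jn) e1);
      rewrite !iter_left_shiftE addn0.
  + by have /(_ 0%N isT) := agree_mdist (n := 1) (lt_le_trans (xy' j jn) e1);
      rewrite !iter_left_shiftE addn0.
- exact: ltW.
Qed.

(** By the two comparisons, the entropy at scale [e] is constant for [e] at most e^{-1}. *)
Lemma htopE : htop X left_shift Z = thin_dim Z.
Proof.
rewrite /htop; apply: (@cvg_lim _) => //.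
apply: cvg_near_cst; near=> e; rewrite /bowen_entropy_at /thin_dim.
have e0 : (0 < e)%R by near: e; exact: nbhs_right_gt.
have e1 : (e <= expR (- 1))%R.
  by near: e; apply: nbhs_right_le; exact: expR_gt0.
congr (ereal_inf [set _%:E | _ in _]); apply/seteqP; split => s [s0 mu]; split => //.
  exact: bowen_thin mu.
exact: thin_bowen.
Unshelve. all: by end_near. Qed.

End entropy.

(** * Hausdorff dimension as a critical exponent *)

Section hausdorff.
Context {R : realType} {A : finType}.
Variable Z : set (full_shift R A).
Implicit Types (s : R) (U : set (full_shift R A)).

Lemma diam_ge0 U : 0 <= diam U.
Proof. by apply: ereal_sup_ubound; left. Qed.

Lemma mdist_le_diam U x y : U x -> U y -> (mdist x y)%:E <= diam U.
Proof. by move=> Ux Uy; apply: ereal_sup_ubound; right; exists (x, y). Qed.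

Lemma agree_diam U n : (forall x y, U x -> U y -> agree n x y) ->
  diam U <= (expR (- n%:R))%:E.
Proof.
move=> ag; apply: ge_ereal_sup => _ [->|[[x y] [/= Ux Uy] <-]].
  by rewrite lee_fin expR_ge0.
by rewrite lee_fin ltW// mdist_agree_lt//; exact: ag.
Qed.

Lemma hausdorff_premeasure_ge0 s delta : 0 <= hausdorff_premeasure Z s delta.
Proof.
apply: le_ereal_inf_tmp => _ [D [U [_ _ ->]]]; apply: esum_ge0 => i _.
exact: poweR_ge0.
Qed.

(** The premeasure grows as [delta] decreases, so its limit at 0 is a supremum. *)
Lemma hausdorff_measure0 s : hausdorff_measure Z s = 0 <->
  forall delta, (0 < delta)%R -> hausdorff_premeasure Z s delta = 0.
Proof.
rewrite /hausdorff_measure.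
have ni : {in Interval (BRight 0%R) +oo%O &, nonincreasing_fun (hausdorff_premeasure Z s)}.
  move=> d d' _ _ dd'; apply: le_ereal_inf_tmp => _ [D [U [DU ZU ->]]].
  apply: ereal_inf_lbound; exists D, U; split => // i /DU /le_trans; apply.
  by rewrite lee_fin.
have cv := @nonincreasing_at_right_cvge R (hausdorff_premeasure Z s) 0%R +oo%O isT ni.
rewrite (cvg_lim _ cv)//; split => [sup0 delta d0|H0].
  apply/eqP; rewrite eq_le hausdorff_premeasure_ge0 andbT -[leRHS]sup0.
  by apply: ereal_sup_ubound; exists delta => //=; rewrite in_itv/= d0.
apply/eqP; rewrite eq_le; apply/andP; split.
  apply: ge_ereal_sup => _ [d /= + <-]; rewrite in_itv/= andbT => d0.
  by rewrite H0.
rewrite -(H0 1%R)//; apply: ereal_sup_ubound; exists 1%R => //=.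
by rewrite in_itv/= andbT.
Qed.

Lemma thin_hausdorff s : (0 <= s)%R -> thin Z s -> hausdorff_measure Z s = 0.
Proof.
move=> s0 Zs; apply/hausdorff_measure0 => delta d0.
apply: le0_eqe => [|eta eta0]; first exact: hausdorff_premeasure_ge0.
have [k ke] := exists_expRN_le d0.
have [D [U [n [DU ZU cost]]]] := Zs k eta eta0.
have dn i : D i -> diam (Z `&` U i) <= (expR (- (n i)%:R))%:E.
  move=> /DU[_ ag]; apply: agree_diam => x y [Zx Ux] [Zy Uy]; exact: ag.
apply: le_trans cost.
apply: (@le_trans _ _ (\esum_(i in D) (diam (Z `&` U i) `^ s))).
  apply: ereal_inf_lbound; exists D, (fun i => Z `&` U i); split => //.
    move=> i Di; apply: le_trans (dn i Di) _; rewrite lee_fin (le_trans _ ke)//.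
    by rewrite ler_expR lerN2 ler_nat (DU i Di).1.
  by move=> x Zx; have [i Di Uix] := ZU x Zx; exists i.
apply: le_esum => i Di.
apply: (@le_trans _ _ ((expR (- (n i)%:R))%:E `^ s)).
  apply: gt0_ler_poweR => //; last exact: dn.
  - by rewrite in_itv/= diam_ge0 leey.
  - by rewrite in_itv/= lee_fin expR_ge0 leey.
by rewrite poweR_EFin lee_fin /powR gt_eqF ?expR_gt0// expRK mulrN mulNr.
Qed.

(** A set of diameter [d] lies in a cylinder of length about [- ln d]. A set of diameter 0 lies in
    arbitrarily long cylinders, whose cost tends to 0 because [s'] is positive; these errors sum to
    at most [eta / 2]. *)
Lemma hausdorff_thin s s' : (0 <= s)%R -> (s < s')%R ->
  hausdorff_measure Z s = 0 -> thin Z s'.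
Proof.
move=> s0 ss' /hausdorff_measure0 H0 m eta eta0.
have s'0 : (0 < s')%R by exact: le_lt_trans ss'.
(* One letter is lost in truncating [- ln d], another to the strict inequality in [agree_mdist];
   each costs a factor at most e^{s'}. *)
pose C := expR (2 * s').
have C0 : (0 < C)%R by exact: expR_gt0.
have := H0 (expR (- m.+2%:R)) (expR_gt0 _).
move=> /eqP; rewrite eq_le => /andP[+ _].
have e20 : (0 < eta / 2 / C)%R by rewrite !divr_gt0.
move=> /le_lt_trans => /(_ (eta / 2 / C)%:E).
rewrite lte_fin => /(_ e20) /ereal_inf_lt[_ [D [U [DU ZU ->]]] lteta].
have /choice[n nP] i : exists n, D i -> [/\ (m <= n)%N,
    forall x y, U i x -> U i y -> agree n x y &
    (expR (- s' * n%:R))%:E <= C%:E * (diam (U i) `^ s) + (eta / 2 / (2 ^ i.+1)%:R)%:E].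
  have [Di|] := pselect (D i); last by exists 0%N.
  have := DU i Di; have := diam_ge0 (U i).
  have ei0 : (0 < eta / 2 / (2 ^ i.+1)%:R)%R.
    by rewrite !divr_gt0// ltr0n expn_gt0.
  have agd n : diam (U i) < (expR (- n%:R))%:E -> forall x y, U i x -> U i y -> agree n x y.
    move=> dn x y Ux Uy; apply: (@agree_mdist R); rewrite -lte_fin.
    exact: le_lt_trans (mdist_le_diam Ux Uy) dn.
  case: (diam (U i)) agd => [d||]// agd; rewrite !lee_fin => d0 dm.
  have [d00|dn0] := eqVneq d 0%R.
    have [k ke] := exists_expRN_le ei0.
    pose n := maxn m (Num.truncn (k%:R / s')).+1.
    exists n => _; split; first exact: leq_maxl.
      by apply: agd; rewrite d00 lte_fin expR_gt0.
    apply: (@le_trans _ _ (eta / 2 / (2 ^ i.+1)%:R)%:E).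
      rewrite lee_fin (le_trans _ ke)// ler_expR mulNr lerN2 mulrC -ler_pdivrMr//.
      by rewrite (le_trans (ltW (truncnS_gt _)))// ler_nat leq_maxr.
    by rewrite leeDr// mule_ge0 ?poweR_ge0// lee_fin ltW.
  have {dn0}d0 : (0 < d)%R by rewrite lt_neqAle eq_sym dn0.
  have ld : (m.+2%:R <= - ln d)%R by rewrite lerNr -[leRHS]expRK ler_ln ?posrE ?expR_gt0.
  pose t := Num.truncn (- ln d).
  have lnd0 : (0 <= - ln d)%R by apply: le_trans ld.
  have /andP[t1 t2] := truncn_itv lnd0; rewrite -/t in t1 t2; clearbody t.
  have mt : (m.+1 < t)%N.
    by rewrite -ltnS -(ltr_nat R) (le_lt_trans ld).
  have dE : d = expR (ln d) by rewrite lnK.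
  have t0 : (0 < t)%N by exact: leq_trans mt.
  exists t.-1 => _; split; first by rewrite -ltnS prednK// ltnW.
    apply: agd; rewrite lte_fin [ltLHS]dE ltr_expR ltrNr.
    by apply: lt_le_trans t1; rewrite ltr_nat prednK.
  apply: (@le_trans _ _ (C%:E * (d%:E `^ s))); last first.
    by rewrite leeDl// lee_fin ltW.
  rewrite poweR_EFin -EFinM lee_fin /powR gt_eqF// -expRD ler_expR.
  have -> : (t.-1%:R = t%:R - 1 :> R)%R by rewrite -[X in (_ = X%:R - 1)%R](prednK t0) -natr1 addrK.
  rewrite -natr1 in t2.
  have : (s' * (- ln d - 2) <= s' * (t%:R - 1))%R by rewrite ler_pM2l//; lra.
  have : (s * - ln d <= s' * - ln d)%R by rewrite ler_wpM2r// ltW.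
  lra.
exists D, U, n; split => //.
- by move=> i Di; have [mn ag _] := nP i Di; split => // x y _ _; exact: ag.
apply: (@le_trans _ _ (\esum_(i in D) (C%:E * (diam (U i) `^ s) + (eta / 2 / (2 ^ i.+1)%:R)%:E))).
  by apply: le_esum => i /nP[].
rewrite esumD; first last.
- by move=> i _; rewrite lee_fin divr_ge0// ltW// divr_gt0.
- by move=> i _; rewrite mule_ge0 ?poweR_ge0// lee_fin ltW.
rewrite [eta in leRHS]splitr EFinD; apply: leeD.
  apply: le_trans (esumZ_le _ (ltW C0) (fun=> poweR_ge0 _ _)) _.
  rewrite -[(eta / 2)%R](@divfK _ C) ?gt_eqF// mulrC EFinM.
  by apply: lee_pmul => //; [rewrite lee_fin ltW|apply: esum_ge0 => *; exact: poweR_ge0|exact: ltW].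
apply: le_trans (epsilon_trick0 xpredT _); last by rewrite ltW// divr_gt0.
rewrite nneseries_esumT.
  by apply: le_esum_subset => // i; rewrite lee_fin divr_ge0// ltW// divr_gt0.
by move=> i; rewrite lee_fin divr_ge0// ltW// divr_gt0.
Qed.

Lemma hausdorff_dimE : hausdorff_dim Z = thin_dim Z.
Proof.
apply/eqP; rewrite eq_le; apply/andP; split.
  apply: le_ereal_inf_tmp => _ [s [s0 Zs] <-]; apply: ereal_inf_lbound.
  by exists s => //; split => //; exact: thin_hausdorff.
apply: le_ereal_inf_tmp => _ [s [s0 Hs] <-]; apply/lee_addgt0Pr => e e0.
apply: ereal_inf_lbound; exists (s + e)%R => //; split; first by rewrite addr_ge0 // ltW.
by apply: hausdorff_thin Hs => //; rewrite ltrDl.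
Qed.

End hausdorff.

(** * Growth of the language *)

Section language.
Context {R : realType} {A : finType}.
Implicit Types (X Y : set (full_shift R A)) (x : full_shift R A).

Definition word n (x : nat -> A) : n.-tuple A := [tuple of mkseq x n].

Lemma wordP n (x y : nat -> A) : word n x = word n y <-> agree n x y.
Proof.
split=> [/(congr1 val)/= xy i ni|xy].
  by have := congr1 (nth (x i) ^~ i) xy; rewrite !nth_mkseq.
apply: val_inj; apply: (@eq_from_nth _ (x 0%N)); rewrite !size_mkseq// => i ni.
by rewrite !nth_mkseq// xy.
Qed.

Definition lang X n : {set n.-tuple A} := finset (fun w => `[< exists2 x, X x & word n x = w >]).

Lemma langP X n w : reflect (exists2 x, X x & word n x = w) (w \in lang X n).
Proof. by rewrite inE; exact: asboolP. Qed.

Lemma card_lang_gt0 X n : X !=set0 -> (0 < #|lang X n|)%N.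
Proof. by move=> [x Xx]; apply/card_gt0P; exists (word n x); apply/langP; exists x. Qed.

Section growth.
Variable X : set (full_shift R A).
Hypotheses (X0 : X !=set0) (XX : left_shift @` X `<=` X).

Lemma iter_left_shift_in n x : X x -> X (iter n left_shift x).
Proof. by move=> Xx; elim: n => //= n IHn; apply: XX; exists (iter n left_shift x). Qed.

Lemma card_langD m n : (#|lang X (m + n)| <= #|lang X m| * #|lang X n|)%N.
Proof.
rewrite -cardsX.
apply: leq_trans (leq_imset_card (fun uv : m.-tuple A * n.-tuple A => [tuple of uv.1 ++ uv.2]) _).
apply/subset_leq_card/fintype.subsetP => _ /langP[x Xx <-].
apply/imsetP; exists (word m x, word n (iter m left_shift x)).
  rewrite finset.in_setX; apply/andP; split; apply/langP; first by exists x.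
  by exists (iter m left_shift x) => //; exact: iter_left_shift_in.
apply: val_inj; rewrite /= /mkseq iotaD map_cat add0n; congr (_ ++ _).
rewrite -[X in iota X]addn0 iotaDl -map_comp; apply: eq_map => k /=.
by rewrite iter_left_shiftE.
Qed.

Lemma card_langMD q k r : (#|lang X (q * k + r)| <= #|lang X k| ^ q * #|lang X r|)%N.
Proof.
elim: q => [|q IHq]; first by rewrite mul0n add0n expn0 mul1n.
rewrite mulSn -addnA (leq_trans (card_langD _ _))// expnS -mulnA leq_mul2l.
by rewrite IHq orbT.
Qed.

(** For a non-empty shift-invariant [X] this infimum is, by Fekete's lemma, the exponential growth
    rate of the number of words. *)
Definition growth : R :=
  inf [set (ln #|lang X n.+1|%:R / n.+1%:R)%R | n in [set: nat]].

Let lang1 n : (1 <= #|lang X n|%:R :> R)%R.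
Proof. by rewrite ler1n card_lang_gt0. Qed.

Lemma growth_has_inf :
  has_inf [set (ln #|lang X n.+1|%:R / n.+1%:R : R)%R | n in [set: nat]].
Proof.
split; first by exists (ln #|lang X 1|%:R / 1%:R)%R, 0%N.
by exists 0%R => _ [n _ <-]; rewrite divr_ge0// ln_ge0.
Qed.

Lemma growth_ge0 : (0 <= growth)%R.
Proof.
apply: lb_le_inf; first exact: growth_has_inf.1.
by move=> _ [n _ <-]; rewrite divr_ge0// ln_ge0.
Qed.

Lemma growth_lb n : (expR (n%:R * growth) <= #|lang X n|%:R)%R.
Proof.
case: n => [|n]; first by rewrite mul0r expR0.
have L0 : (0 < #|lang X n.+1|%:R :> R)%R by exact: lt_le_trans (lang1 _).
rewrite -[leRHS]lnK// ler_expR mulrC -ler_pdivlMr//.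
by apply: ge_inf; [exact: growth_has_inf.2|exists n].
Qed.

(** Fekete's argument: fix a length whose rate is below [h], cut words into pieces of that length,
    and absorb the remainder into [C]. *)
Lemma growth_ub h : (growth < h)%R -> exists2 C : R, (0 < C)%R &
  forall n, (#|lang X n|%:R <= C * expR (n%:R * h))%R.
Proof.
move=> gh; have [_ [k _ <-] kh] := inf_lt growth_has_inf.1 gh.
have h0 : (0 < h)%R by exact: le_lt_trans growth_ge0 gh.
pose C := (\sum_(r < k.+1) #|lang X r|%:R : R)%R.
have C0 r : (r < k.+1)%N -> (#|lang X r|%:R <= C)%R.
  move=> rk; rewrite /C (bigD1 (Ordinal rk))//= lerDl sumr_ge0//.
exists C; first by apply: lt_le_trans (C0 0%N isT); exact: lt_le_trans (lang1 _).
move=> n; rewrite (divn_eq n k.+1).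
have Lk : (#|lang X k.+1|%:R <= expR (k.+1%:R * h))%R.
  have L0 : (0 < #|lang X k.+1|%:R :> R)%R by exact: lt_le_trans (lang1 _).
  by rewrite -[leLHS]lnK// ler_expR mulrC -ler_pdivrMr// ltW.
apply: (@le_trans _ _ (#|lang X k.+1|%:R ^+ (n %/ k.+1) * #|lang X (n %% k.+1)|%:R)%R).
  by rewrite -natrX -natrM ler_nat card_langMD.
rewrite mulrC; apply: ler_pM => //; first exact: C0 (ltn_pmod _ _).
apply: (@le_trans _ _ (expR (k.+1%:R * h) ^+ (n %/ k.+1))%R).
  by rewrite lerXn2r// nnegrE// expR_ge0.
rewrite -expRM_natl ler_expR natrD natrM.
by rewrite mulrA ler_wpM2r ?(ltW h0)// lerDl.
Qed.

End growth.

(** A word of [X] of length [n] is read at some offset [l < N] in a word of [Y] of length [n + N];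
    the offset and the longer word determine it. *)
Lemma card_lang_bigcup X Y N n : Y !=set0 ->
  X `<=` \bigcup_(l < N) (iter l left_shift @` Y) ->
  (#|lang X n| <= N * #|lang Y (n + N)|)%N.
Proof.
move=> [y0 Yy0] XY; rewrite -[N in (N * _)%N]card_ord -cardsT -cardsX.
pose F (lw : 'I_N * (n + N).-tuple A) := word n (fun i => nth (y0 0%N) lw.2 (lw.1 + i)).
apply: leq_trans (leq_imset_card F _).
apply/subset_leq_card/fintype.subsetP => _ /langP[x Xx <-].
have [l /= lN [y Yy yx]] := XY x Xx.
apply/imsetP; exists (Ordinal lN, word (n + N) y).
  by rewrite finset.in_setX finset.in_setT/=; apply/langP; exists y.
apply/wordP => i ni /=; rewrite -yx iter_left_shiftE nth_mkseq//.
by rewrite addnC -addnS leq_add// ltnW.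
Qed.

End language.

Lemma esum_seq_cst (R : realType) (I : choiceType) (r : seq I) (c : R) :
  uniq r -> (0 <= c)%R -> \esum_(i in [set` r]) c%:E = (c *+ size r)%:E.
Proof.
move=> ur c0; rewrite esum_fset//.
by rewrite -fsbig_seq// sumEFin big_const_seq count_predT iter_addr_0.
Qed.

Lemma esum_geometric_le (R : realType) (a x : R) :
  (0 <= a)%R -> (0 < x < 1)%R ->
  \esum_(k in [set: nat]) (a * x ^+ k)%:E <= (a / (1 - x))%:E.
Proof.
move=> a0 /andP[x0 x1].
have ax0 k : 0 <= (a * x ^+ k)%:E by rewrite lee_fin mulr_ge0// exprn_ge0// ltW.
rewrite -nneseries_esumT//; apply: lime_le; first exact: is_cvg_nneseries.
apply: nearW => n; rewrite sumEFin lee_fin; apply: geometric_le_lim => //.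
by rewrite ger0_norm// ltW.
Qed.

(** * The upper bound *)

Section thin_upper.
Context {R : realType} {A : finType}.
Variables (X Z : set (full_shift R A)) (z : nat -> full_shift R A) (K : nat -> nat).
Hypotheses (X0 : X !=set0) (XX : left_shift @` X `<=` X) (ZX : Z `<=` X).
Hypothesis hitting : forall x, Z x -> forall m, exists2 n, (m <= n)%N &
  agree (K n) (iter n left_shift x) (z n).

(** A Borel-Cantelli argument: points hitting at time [n] with the same first [n] letters share
    [n + K n] letters. With at most [C] e^{n h'} such classes, the costs are dominated by a
    geometric series of ratio [x < 1]. The [- 1] left by truncation costs only a factor e^s. *)
Lemma limsup_thin (s tau : R) n0 : (0 <= s)%R ->
  (forall n, (n0 <= n)%N -> n%:R * tau - 1 <= (K n)%:R)%R ->
  (growth X < s * (1 + tau))%R -> thin Z s.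
Proof.
move=> s0 Ktau gs.
have [h' gh hs] : exists2 h', (growth X < h')%R & (h' < s * (1 + tau))%R.
  by exists ((growth X + s * (1 + tau)) / 2)%R; lra.
have [C C0 CP] := growth_ub X0 XX gh.
pose x := expR (h' - s * (1 + tau)).
have x0 : (0 < x)%R by exact: expR_gt0.
have x1 : (x < 1)%R by rewrite expR_lt1 subr_lt0.
apply: (@thinI _ _ (nat * seq A)%type) => m eta eta0.
pose a0 := (C * expR s / (1 - x))%R.
have a00 : (0 < a0)%R by rewrite divr_gt0 ?subr_gt0// mulr_gt0// expR_gt0.
have [m1 m1P] : exists m1, forall k, (m1 <= k)%N -> (a0 * x ^+ k <= eta)%R.
  have xn1 : (`|x| < 1)%R by rewrite ger0_norm// ltW.
  have /cvgrPdist_le /(_ _ eta0) [m1 _ m1P] := cvg_geometric a0 xn1.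
  exists m1 => k /m1P /=; rewrite sub0r normrN ger0_norm//.
  by rewrite mulr_ge0 ?exprn_ge0// ltW.
(* [M] makes the cylinders long enough, puts all times [M + k] beyond [n0], and makes the tail of
   the series at most [eta]. *)
pose M := maxn m (maxn n0 m1).
pose J k := [set` [seq val w | w <- enum (lang X (M + k))]].
exists ([set: nat] `*`` J), (fun kw => [set y : full_shift R A | mkseq y (M + kw.1) = kw.2 /\
   agree (K (M + kw.1)) (iter (M + kw.1) left_shift y) (z (M + kw.1))]),
   (fun kw => (M + kw.1) + K (M + kw.1))%N; split.
- move=> [k w] /= _; split.
    by rewrite -addnA (leq_trans (leq_maxl m (maxn n0 m1)))// leq_addr.
  move=> y y' _ _ [yw yz] [y'w y'z] i iMK.
  have yy' : agree (M + k) y y' by apply/wordP; apply: val_inj; rewrite /= yw.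
  have [/yy'//|Mki] := ltnP i (M + k).
  have := agree_trans yz (agree_sym y'z) (i := (i - (M + k))%N).
  by rewrite !iter_left_shiftE subnKC//; apply; rewrite ltn_subLR.
- move=> y Zy; have [n Mn] := hitting Zy M.
  rewrite -(subnKC Mn); move: (n - M)%N => k yz.
  exists (k, mkseq y (M + k)) => //; split => //=.
  apply/mapP; exists (word (M + k) y) => //; rewrite mem_enum.
  by apply/langP; exists y => //; exact: ZX.
have M1 : (m1 <= M)%N by rewrite /M !leq_max leqnn !orbT.
have M0 : (n0 <= M)%N by rewrite /M !leq_max leqnn orbT.
rewrite -(esum_esum (a := fun k w => (expR (- s * (M + k + K (M + k))%:R))%:E)); last first.
  by move=> *; rewrite lee_fin expR_ge0.
apply: (@le_trans _ _ (\esum_(k in [set: nat]) ((C * expR s * x ^+ M) * x ^+ k)%:E)); last first.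
  apply: le_trans (esum_geometric_le _ _) _; rewrite ?x0 ?x1//.
    by rewrite !mulr_ge0 ?exprn_ge0 ?expR_ge0// ltW.
  by rewrite lee_fin mulrAC m1P.
apply: le_esum => k _.
rewrite esum_seq_cst ?expR_ge0//; last by rewrite map_inj_uniq ?enum_uniq//; exact: val_inj.
rewrite size_map -cardE lee_fin -[leLHS]mulr_natl.
apply: (@le_trans _ _ (C * expR ((M + k)%:R * h') * expR (- s * (M + k + K (M + k))%:R))%R).
  by rewrite ler_wpM2r ?expR_ge0 ?CP.
rewrite -!mulrA ler_pM2l// -exprD -[(x ^+ _)%R]expRM_natl -!expRD ler_expR.
have := Ktau _ (leq_trans M0 (leq_addr k M)).
move: (K _) => Kn; move: (M + k)%N => n; rewrite natrD => nK.
have : (s * (n%:R * tau - 1) <= s * Kn%:R)%R by exact: ler_wpM2l.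
lra.
Qed.

End thin_upper.

(** * A Kraft inequality for covers *)

Section cylinder_cover.
Context {R : realType} {E : finType}.
Implicit Types c : nat -> E.

Let M : R := #|E|%:R.

Let upd c k a : nat -> E := fun i => if i == k then a else c i.

Let upd_agree c k a : agree k c (upd c k a).
Proof. by move=> i ik; rewrite /upd ltn_eqF. Qed.

(* The proportion of the continuations of the first [k] letters of [c] lying in
   the cylinder of length [b] around [p]. *)
Definition cylinder_weight (p : nat -> E) b k c : R :=
  if `[< agree (minn k b) p c >] then (M ^- (b - k))%R else 0%R.

Let weight_ge0 p b k c : (0 <= cylinder_weight p b k c)%R.
Proof. by rewrite /cylinder_weight; case: ifP => // _; rewrite invr_ge0 exprn_ge0// ler0n. Qed.

Let M0 (e : E) : (0 < M)%R.
Proof. by rewrite ltr0n; apply/card_gt0P; exists e. Qed.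

(** A martingale property: the weight is the average of its values over the next letter. *)
Let weight_sum p b k c :
  (\sum_(a : E) cylinder_weight p b k.+1 (upd c k a) = M * cylinder_weight p b k c)%R.
Proof.
rewrite {2}/cylinder_weight; case: asboolP => pc; last first.
  rewrite mulr0 big1// => a _; rewrite /cylinder_weight; case: asboolP => // pc'.
  case: pc => i; rewrite leq_min => /andP[ik ib].
  rewrite pc' ?leq_min ?ib ?ltnS 1?ltnW//.
  by rewrite -(@upd_agree c k a).
have [bk|kb] := leqP b k.
  rewrite (eq_bigr (fun=> 1%R)) ?sumr_const; last first.
    move=> a _; rewrite /cylinder_weight asboolT; last first.
      move=> i; rewrite leq_min => /andP[_ ib]; rewrite pc ?leq_min ?ib ?(leq_trans ib bk)//.
      by rewrite -(@upd_agree c k a)// (leq_trans ib bk).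
    by move: (bk); rewrite -subn_eq0 => /eqP bk0; rewrite subnS bk0 expr0 invr1.
  by move: bk; rewrite -subn_eq0 => /eqP ->; rewrite expr0 invr1 mulr1.
rewrite (bigD1 (p k))//= [X in (_ + X)%R]big1 ?addr0; last first.
  move=> a apk; rewrite /cylinder_weight; case: asboolP => // /(_ k).
  by rewrite leq_min leqnn kb /upd eqxx => /(_ isT) /esym/eqP; rewrite (negbTE apk).
rewrite /cylinder_weight asboolT.
  rewrite subnS -(prednK (_ : 0 < b - k)%N) ?subn_gt0//= exprS invfM mulrA divff ?mul1r//.
  by rewrite gt_eqF// (M0 (c 0%N)).
move=> i; rewrite leq_min ltnS => /andP[ik ib].
rewrite /upd; case: eqP => [->//|/eqP ink].
by rewrite pc// leq_min ib andbT ltn_neqAle ink.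
Qed.

(** If the total were below 1, averaging would always give a next letter keeping the conditional
    weight below 1. The sequence so built lies in some [P i], and at depth [b i] that piece alone
    weighs 1. *)
Lemma cylinder_cover_ge1 (e0 : E) (D : set nat) (P : nat -> set (nat -> E)) (b : nat -> nat) :
  (forall i c c', D i -> P i c -> P i c' -> agree (b i) c c') ->
  (forall c, exists2 i, D i & P i c) ->
  1 <= \esum_(i in D) (M ^- b i)%:E.
Proof.
move=> Pb cov; rewrite leNgt; apply/negP => lt1.
have /choice[p pP] i : exists c, P i !=set0 -> P i c.
  have [[c Pc]|nP] := pselect (P i !=set0); first by exists c.
  by exists (fun=> e0) => /nP.
pose S k c := \esum_(i in D) (cylinder_weight (p i) (b i) k c)%:E.
have S0 c : S 0%N c < 1.
  apply: le_lt_trans lt1; apply: le_esum => i _; rewrite lee_fin /cylinder_weight min0n subn0.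
  by rewrite asboolT.
have step k c : exists a, S k c < 1 -> S k.+1 (upd c k a) < 1.
  have [[a Sa]|nS] := pselect (exists a, S k.+1 (upd c k a) < 1); first by exists a.
  exists e0 => Sk; exfalso.
  have ge1 a : 1 <= S k.+1 (upd c k a).
    by rewrite leNgt; apply/negP => Sa; apply: nS; exists a.
  have : \sum_(a : E) S k.+1 (upd c k a) <= M%:E * S k c.
    rewrite /S -esum_sum; last by move=> *; rewrite lee_fin.
    under eq_esum do rewrite sumEFin weight_sum EFinM.
    by apply: esumZ_le => // i; rewrite lee_fin.
  apply/negP; rewrite -ltNge; apply: (@lt_le_trans _ _ M%:E).
    by rewrite -[ltRHS]mule1 lte_pmul2l// lte_fin (M0 e0).
  apply: (@le_trans _ _ (\sum_(a : E) 1)); last exact: lee_sum.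
  by rewrite sumEFin sumr_const lee_fin ler_nat; exact/subset_leq_card/fintype.subsetP.
have /choice[nx nxP] (kc : nat * (nat -> E)) : exists a, S kc.1 kc.2 < 1 -> S kc.1.+1 (upd kc.2 kc.1 a) < 1.
  exact: step.
pose st := fix st k := if k is k'.+1 then upd (st k') k' (nx (k', st k')) else (fun=> e0).
have stS k : S k (st k) < 1 by elim: k => [|k IHk] //=; apply: (nxP (k, st k)).
have st_agree k l : (k <= l)%N -> agree k (st k) (st l).
  elim: l => [|l IHl]; first by rewrite leqn0 => /eqP ->.
  rewrite leq_eqVlt => /predU1P[->//|]; rewrite ltnS => kl.
  by apply: agree_trans (IHl kl) _; apply: agreeW kl _; exact: upd_agree.
(* Letter [n] is fixed from stage [n.+1] on, so the diagonal is the limit. *)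
pose c n := st n.+1 n.
have c_agree k : agree k (st k) c.
  by move=> i ik; rewrite /c (st_agree i.+1 k).
have [i Di Pic] := cov c.
have := stS (b i); apply/negP; rewrite -leNgt.
apply: (@le_trans _ _ (\esum_(j in [set i]) (cylinder_weight (p j) (b j) (b i) (st (b i)))%:E)).
  rewrite esum_set1 ?lee_fin// /cylinder_weight subnn minnn asboolT ?expr0 ?invr1//.
  apply: agree_trans (agree_sym (@c_agree _)).
  by apply: (Pb _ _ _ Di _ Pic); apply: pP; exists c.
by apply: le_esum_subset => [j -> //|j]; rewrite lee_fin.
Qed.

End cylinder_cover.

(** * Gluing words *)

Section gluing.
Context {R : realType} {A : finType}.
Implicit Types (Y : set (full_shift R A)) (w x y : full_shift R A).

(** [v] is a cluster point of the sequence; its ball of radius e^{-L} is a cylinder of length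
    [L]. *)
Lemma compact_agree Y (w : nat -> full_shift R A) : compact Y -> (forall i, Y (w i)) ->
  exists2 v, Y v & forall k L, exists2 i, (k <= i)%N & agree L v (w i).
Proof.
move=> Yc Yw; have [|v [Yv clv]] := Yc (w @ \oo) _.
  by exists 0%N => // i _ /=; exact: Yw.
exists v => // k L.
have wk : (w @ \oo) [set w i | i in [set i | (k <= i)%N]].
  by exists k => // i /= ki; exists i.
have [_ [[i /= ki <-] vi]] := clv _ _ wk (nbhsx_ballx v (expR (- L%:R)) (expR_gt0 _)).
exists i => //; apply: (@agree_mdist R); by rewrite ballEmdist in vi.
Qed.

(* A block [(x, n, q)] prescribes the first [N * n] letters, copied from [x],
   and leaves the next [N * q] letters free. *)
Local Notation block := (full_shift R A * nat * nat)%type.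

Definition block_size (b : block) := (b.1.2 + b.2)%N.

Fixpoint follows N (bs : seq block) w : Prop :=
  if bs is b :: bs' then
    agree (N * b.1.2) b.1.1 w /\ follows N bs' (iter (N * block_size b) left_shift w)
  else True.

Lemma follows_cat N bs bs' w : follows N (bs ++ bs') w <->
  follows N bs w /\ follows N bs' (iter (N * \sum_(b <- bs) block_size b)%N left_shift w).
Proof.
elim: bs w => [|b bs IH] w /=; first by rewrite big_nil muln0; tauto.
by rewrite IH big_cons mulnDr [(N * _ + N * _)%N]addnC iterD; tauto.
Qed.

Lemma follows_agree N bs w w' : agree (N * \sum_(b <- bs) block_size b) w w' ->
  follows N bs w -> follows N bs w'.
Proof.
elim: bs w w' => //= b bs IH w w'; rewrite big_cons => ww' [bw bsw]; split.
  apply: agree_trans bw _; apply: agreeW ww'; rewrite leq_mul2l /block_size; lia.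
apply: IH bsw; apply: agree_iter_left_shift; apply: agreeW ww'.
by rewrite mulnDr.
Qed.

Lemma follows_nth N d bs w :
  (forall i, (i < size bs)%N -> agree (N * (nth d bs i).1.2) (nth d bs i).1.1
     (iter (N * \sum_(j < i) block_size (nth d bs j)) left_shift w)) ->
  follows N bs w.
Proof.
elim: bs w => //= b bs IH w H; split.
  by have := H 0%N isT; rewrite big_ord0 muln0.
apply: IH => i ib; have := H i.+1 ib.
by rewrite big_ord_recl /= mulnDr addnC iterD.
Qed.

Lemma follows_mkseq N (x : nat -> full_shift R A) m q a n w :
  follows N [seq (x r, m, q) | r <- iota a n] w -> forall r, (r < n)%N ->
  agree (N * m) (x (a + r)%N) (iter (N * (r * (m + q))) left_shift w).
Proof.
elim: n a w => //= n IH a w [xw follow] [_|r]; first by rewrite addn0 mul0n muln0.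
rewrite ltnS => /(IH _ _ follow).
by rewrite addSnnS /block_size/= -iterD -mulnDr [(r * _ + _)%N]addnC.
Qed.

Definition admissible Y (p : nat -> nat) (b : block) : Prop :=
  [/\ Y b.1.1, (0 < b.1.2)%N & (p b.1.2 <= b.2)%N].

(** At scale e^{-N} closeness means agreement on [N] letters, so shadowing [n] steps of
    [iter N left_shift] copies [N * n] consecutive letters. *)
Lemma specification_follows Y N : Y !=set0 ->
  nonuniform_specification Y (iter N left_shift) ->
  exists2 p : nat -> nat,
    limn_esup (fun n => ((p n)%:R / n%:R)%:E : \bar R) = 0 &
    forall bs : seq block, (forall b, b \in bs -> admissible Y p b) ->
      exists2 w, Y w & follows N bs w.
Proof.
move=> [y0 Yy0] /(_ (expR (- N%:R)) (expR_gt0 _))[p [_ plim spec]].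
exists p => // -[|b0 bs'] bsP; first by exists y0.
move: (b0 :: bs') (isT : 0 < size (b0 :: bs'))%N bsP => bs bs0 bsP.
pose b i := nth b0 bs i.
have [i ib|w Yw wP] := spec (size bs) (fun i => (b i).1.1) (fun i => (b i).1.2) (fun i => (b i).2) bs0.
  by apply: bsP; exact: mem_nth.
exists w => //; apply: (@follows_nth _ b0) => i ib j.
rewrite -/(b i); have [_ {}wP] := wP i ib => jN.
have [N0|N0] := posnP N; first by move: jN; rewrite N0.
have jn : (j %/ N < (b i).1.2)%N by rewrite ltn_divLR// mulnC.
have /agree_mdist/(_ (j %% N)%N) := wP _ jn.
rewrite ltn_pmod// => /(_ isT); rewrite !iter_iter !iter_left_shiftE -divn_eq => ->.
by rewrite mulnC.
Qed.

(** Glue the first [k] stages for every [k] and take a cluster point: each stage constrains finitely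
    many letters, hence survives in the limit. *)
Lemma infinite_gluing Y N (p : nat -> nat) (S : nat -> seq block) : compact Y ->
  (forall bs : seq block, (forall b, b \in bs -> admissible Y p b) ->
        exists2 w, Y w & follows N bs w) ->
  (forall k b, b \in S k -> admissible Y p b) ->
  exists2 w, Y w & forall k, follows N (S k)
    (iter (N * \sum_(i < k) \sum_(b <- S i) block_size b) left_shift w).
Proof.
move=> Yc glue SP.
pose P k : seq block := flatten [seq S i | i <- iota 0 k].
have Psum k : (\sum_(b <- P k) block_size b = \sum_(i < k) \sum_(b <- S i) block_size b)%N.
  by rewrite big_flatten big_map -(big_mkord xpredT (fun i => \sum_(b <- S i) block_size b)%N) /index_iota subn0.
have /choice[w wP] k : exists w, Y w /\ follows N (P k) w.
  have [b /flattenP[_ /mapP[i _ ->]]|w Yw wP] := glue (P k); first exact: SP.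
  by exists w.
have [i|v Yv vP] := compact_agree Yc (w := w); first exact: (wP i).1.
exists v => // k.
have [i ki vi] := vP k.+1 (N * \sum_(b <- P k.+1) block_size b)%N.
have PD : P i = P k.+1 ++ flatten [seq S j | j <- iota k.+1 (i - k.+1)].
  by rewrite /P -[in LHS](subnKC ki) iotaD add0n map_cat flatten_cat.
have /follows_agree : follows N (P k.+1) (w i).
  by have := (wP i).2; rewrite PD follows_cat => -[].
move=> /(_ v (agree_sym vi)).
by rewrite /P -addn1 iotaD map_cat flatten_cat follows_cat -/(P k) Psum /= cats0 => -[].
Qed.

(** A stage is one long word [y k], a gap, and then as many words of length [N * m] as fit, each
    with its own gap. *)
Lemma staged_gluing Y N (p : nat -> nat) (t l : nat -> nat) (m : nat)
    (y : nat -> full_shift R A) (x : nat -> nat -> full_shift R A) :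
  compact Y ->
  (forall bs : seq block, (forall b, b \in bs -> admissible Y p b) ->
        exists2 w, Y w & follows N bs w) ->
  t 0%N = 0%N -> (0 < m)%N -> (forall k, 0 < l k)%N ->
  (forall k, t k + l k + p (l k) <= t k.+1)%N ->
  (forall k, Y (y k)) -> (forall k r, Y (x k r)) ->
  let Q := (m + p m)%N in
  let r k := ((t k.+1 - (t k + l k + p (l k))) %/ Q)%N in
  exists2 w, Y w & forall k,
    agree (N * l k) (y k) (iter (N * t k) left_shift w) /\
    forall i, (i < r k)%N ->
      agree (N * m) (x k i) (iter (N * (t k.+1 - r k * Q + i * Q)) left_shift w).
Proof.
move=> Yc glue t0 m0 l0 tl Yy Yx Q r.
(* The remainder modulo [Q] goes into the gap after the long word, so that the last free word and
   its gap end exactly at [t k.+1]. *)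
pose G k := (p (l k) + (t k.+1 - (t k + l k + p (l k))) %% Q)%N.
pose S k := (y k, l k, G k) :: [seq (x k i, m, p m) | i <- iota 0 (r k)].
have tS k : t k.+1 = (t k + l k + G k + r k * Q)%N.
  rewrite /G addnA -[in RHS]addnA [(_ %% _ + _)%N]addnC -divn_eq subnKC//.
have sumS k : (\sum_(b <- S k) block_size b = l k + G k + r k * Q)%N.
  by rewrite big_cons big_map (eq_bigr (fun=> Q))// big_const_seq count_predT size_iota iter_addn_0 mulnC.
have sumt k : (\sum_(i < k) \sum_(b <- S i) block_size b = t k)%N.
  by elim: k => [|k IH]; rewrite ?big_ord0// big_ord_recr/= IH sumS tS !addnA.
have [|w Yw wP] := infinite_gluing Yc glue (S := S).
  move=> k b; rewrite inE => /predU1P[->|/mapP[i _ ->]]; split => //=.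
  exact: leq_addr.
exists w => // k; have := wP k; rewrite sumt => -[yw xw]; split => // i ir.
have -> : (t k.+1 - r k * Q + i * Q = i * Q + (l k + G k + t k))%N.
  by rewrite tS addnK; lia.
have := follows_mkseq xw ir; rewrite add0n -!iterD -!mulnDr /block_size/=.
by rewrite -?addnA.
Qed.

End gluing.

(** * The lower bound *)

Lemma limn_esup_lt (R : realType) (u : nat -> \bar R) a :
  limn_esup u < a -> exists n0, forall n, (n0 <= n)%N -> u n < a.
Proof.
move=> /ereal_inf_lt[_ [V [n0 _ nV] <-] Va]; exists n0 => n n0n.
by apply: le_lt_trans Va; apply: ereal_sup_ubound; exists n => //; exact: nV.
Qed.

Lemma lt_limn_einf (R : realType) (u : nat -> \bar R) a :
  a < limn_einf u -> exists n0, forall n, (n0 <= n)%N -> a < u n.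
Proof.
rewrite /limn_einf lteNr => /limn_esup_lt[n0 n0P]; exists n0 => n /n0P.
by rewrite lteN2.
Qed.

Lemma limn_einf_lt (R : realType) (u : nat -> \bar R) a :
  limn_einf u < a -> forall n0, exists2 n, (n0 <= n)%N & u n < a.
Proof.
move=> ua n0; apply: contrapT => H; move: ua; apply/negP; rewrite -leNgt.
rewrite /limn_einf leeNr; apply: ereal_inf_le.
exists (ereal_sup ((\- u) @` [set n | (n0 <= n)%N])).
  by exists [set n | (n0 <= n)%N] => //; exists n0.
apply: ge_ereal_sup => _ [n n0n <-]; rewrite leeN2 leNgt; apply/negP => una.
by apply: H; exists n.
Qed.

Lemma sublinear_le (R : realType) (p : nat -> nat) (d : R) :
  limn_esup (fun n => ((p n)%:R / n%:R)%:E : \bar R) = 0 -> (0 < d)%R ->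
  exists n0, forall n, (n0 <= n)%N -> ((p n)%:R <= d * n%:R)%R.
Proof.
move=> p0 d0.
have /limn_esup_lt[n0 n0P] : limn_esup (fun n => ((p n)%:R / n%:R)%:E : \bar R) < d%:E.
  by rewrite p0 lte_fin.
exists n0.+1 => n n0n; have := n0P n (ltnW n0n); rewrite lte_fin.
by rewrite ltr_pdivrMr ?ltr0n ?(leq_trans _ n0n)// => /ltW.
Qed.

(** * Elementary inequalities behind the rates *)

(** As [D] is at least [1 / delta], everything up to [v] takes at most a fraction [delta] of the
    time [t]; free words of period [Q] fill the rest, up to one period. *)
Lemma stage_end_bound (R : realFieldType) (delta D v t Q r F : R) :
  (0 < delta)%R -> (1 <= delta * D)%R -> (0 <= v)%R -> (0 <= Q * F)%R ->
  (D * v <= t)%R -> (t <= v + Q + r * Q)%R ->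
  ((1 - delta) * t <= Q * (F + r + 1))%R.
Proof.
move=> d0 dD v0 QF Dv tv.
have h1 : (delta * (D * v) <= delta * t)%R by rewrite ler_pM2l.
have h2 : (1 * v <= delta * D * v)%R by rewrite ler_wpM2r.
lra.
Qed.

Lemma target_length_bound (R : realFieldType) (beta N n K l t : R) :
  (0 <= beta)%R -> (1 <= N)%R -> (l * N <= N + K + N)%R -> (n <= N * t + N)%R ->
  (K <= beta * n + 1)%R -> (l <= beta * t + beta + 3)%R.
Proof.
move=> b0 N1 lN nN Kn; have N0 : (0 < N)%R by lra.
have h : (beta * n <= beta * (N * t + N))%R by exact: ler_wpM2l.
rewrite -(ler_pM2r N0); lra.
Qed.

Lemma target_end_bound (R : realFieldType) (beta delta Cp l p t : R) :
  (0 < delta)%R -> (0 <= t)%R -> (l <= beta * t + beta + 3)%R -> (p <= delta * l + Cp)%R ->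
  (t + l + p <= (1 + beta) * (1 + delta) * t + ((1 + delta) * (beta + 3) + Cp))%R.
Proof.
move=> d0 t0 lt pl.
have h : ((1 + delta) * l <= (1 + delta) * (beta * t + beta + 3))%R.
  by rewrite ler_wpM2l//; lra.
have h' : (0 <= delta * t)%R by rewrite mulr_ge0// ltW.
lra.
Qed.

(** The worst moment comes just after a target, when time has been stretched by [lam] without new
    choices. Later each choice takes time [Q], and [lam] is at least 1. *)
Lemma time_bound (R : realFieldType) (lam delta C Q t v F b B : R) :
  (1 <= lam)%R -> (0 < delta < 1)%R -> (0 <= C)%R -> (0 <= Q)%R -> (F <= b)%R ->
  ((1 - delta) * t <= Q * (F + 1))%R -> (v <= lam * t + C)%R ->
  (B <= v + Q + Q * (b - F + 1))%R ->
  ((1 - delta) * B <= lam * Q * b + (lam * Q + C + 2 * Q))%R.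
Proof.
move=> lam1 /andP[d0 d1] C0 Q0 Fb tF vt Bv.
have Qb : (0 <= Q * (b - F))%R by rewrite mulr_ge0// subr_ge0.
have h1 : ((1 - delta) * B <= (1 - delta) * (lam * t + C + Q + Q * (b - F + 1)))%R.
  by rewrite ler_wpM2l//; lra.
have h2 : (lam * ((1 - delta) * t) <= lam * (Q * (F + 1)))%R.
  by rewrite ler_wpM2l//; lra.
have h3 : (Q * (b - F) <= lam * (Q * (b - F)))%R by rewrite ler_peMl.
have h4 : (0 <= delta * (C + Q + Q * (b - F + 1)))%R.
  by rewrite mulr_ge0 ?(ltW d0)//; lra.
lra.
Qed.

(** With [a = h * (1 - 4 * d)] the claim reduces to (1 - 4d)(1 + d)^2 < 1 - d. *)
Lemma exists_slack (R : realFieldType) (a h : R) : (0 <= a)%R -> (a < h)%R ->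
  exists2 d : R, (0 < d < 1)%R & (a * ((1 + d) * (1 + d)) < h * (1 - d))%R.
Proof.
move=> a0 ah; have h0 : (0 < h)%R by lra.
pose d := ((h - a) / (4 * h))%R.
have aE : (a = h * (1 - 4 * d))%R by rewrite /d; field; lra.
have d0 : (0 < d)%R by rewrite divr_gt0 ?subr_gt0// mulr_gt0.
have d1 : (d < 1)%R by rewrite ltr_pdivrMr ?mulr_gt0//; lra.
exists d; first by rewrite d0.
rewrite aE -mulrA ltr_pM2l//; nra.
Qed.

Lemma sublinear_affine (R : realType) (p : nat -> nat) (d : R) :
  limn_esup (fun n => ((p n)%:R / n%:R)%:E : \bar R) = 0 -> (0 < d)%R ->
  exists2 C : R, (0 <= C)%R & forall n, ((p n)%:R <= d * n%:R + C)%R.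
Proof.
move=> p0 d0; have [n0 n0P] := sublinear_le p0 d0.
exists (\sum_(i < n0) (p i)%:R)%R => [|n]; first exact: sumr_ge0.
have [/n0P pn|nn0] := leqP n0 n.
  by apply: le_trans pn _; rewrite lerDl sumr_ge0.
rewrite (bigD1 (Ordinal nn0))//= addrCA lerDl addr_ge0 ?sumr_ge0//.
by rewrite mulr_ge0// ltW.
Qed.

(** [L] stands for the logarithm of the number of free words. The loss [N * h + lnN] does not grow
    with [m'], so the strict gap pays for it once [m'] is large. *)
Lemma alphabet_rate (R : realFieldType) (s beta d h N m' Q lnN L : R) :
  (0 <= s)%R -> (0 <= beta)%R -> (0 < d < 1)%R -> (1 <= N)%R -> (0 <= m')%R ->
  (0 <= N * h + lnN)%R ->
  (0 < h * (1 - d) - s * (1 + beta) * ((1 + d) * (1 + d)))%R ->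
  (N * h + lnN <= (m' + 1) * (h * (1 - d) - s * (1 + beta) * ((1 + d) * (1 + d))))%R ->
  (Q <= (m' + 1) * (1 + d))%R -> (N * m' * h <= lnN + L)%R ->
  (s * N * ((1 + beta) * (1 + d) * Q) <= (1 - d) * L)%R.
Proof.
move=> s0 b0 /andP[d0 d1] N1 m0.
have [G GE] : exists G, G = (N * h + lnN)%R by eexists.
have [gap gapE] : exists g, g = (h * (1 - d) - s * (1 + beta) * ((1 + d) * (1 + d)))%R by eexists.
rewrite -GE -gapE => G0 gap0 Gm Qm NL.
have h1 : (s * N * ((1 + beta) * (1 + d)) * Q <= s * N * ((1 + beta) * (1 + d)) * ((m' + 1) * (1 + d)))%R.
  by rewrite ler_wpM2l// !mulr_ge0//; lra.
have h2 : ((1 - d) * (N * m' * h) <= (1 - d) * (lnN + L))%R by rewrite ler_wpM2l//; lra.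
have h3 : ((m' + 1) * gap <= N * ((m' + 1) * gap))%R.
  by rewrite ler_peMl// mulr_ge0//; lra.
have h4 : (0 <= d * G)%R by rewrite mulr_ge0//; lra.
have -> : (s * N * ((1 + beta) * (1 + d) * Q) = s * N * ((1 + beta) * (1 + d)) * Q)%R by ring.
apply: le_trans h1 _.
have -> : (s * N * ((1 + beta) * (1 + d)) * ((m' + 1) * (1 + d)) = N * (m' + 1) * (h * (1 - d)) - N * ((m' + 1) * gap))%R.
  by rewrite gapE; ring.
have h5 : ((1 - d) * G <= N * ((m' + 1) * gap))%R by lra.
rewrite GE in h5; lra.
Qed.

(** Consequently e^{-s i} is at least a constant times e^{-b L}, the weight of a cylinder fixing [b]
    choices. *)
Lemma cost_rate (R : realFieldType) (s d N a B b L C i : R) :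
  (0 <= s)%R -> (0 < d < 1)%R -> (0 <= N)%R -> (0 <= b)%R ->
  (s * N * a <= (1 - d) * L)%R -> ((1 - d) * B <= a * b + C)%R ->
  (i <= N * B + N)%R -> (s * i <= b * L + (s * N * (C / (1 - d)) + s * N))%R.
Proof.
move=> s0 /andP[d0 d1] N0 b0 aL BC iB.
have d1' : (0 < 1 - d)%R by lra.
have h1 : (s * i <= s * (N * B + N))%R by rewrite ler_wpM2l.
have h2 : (s * N * ((1 - d) * B) <= s * N * (a * b + C))%R by rewrite ler_wpM2l// mulr_ge0.
have h3 : (s * N * a * b <= (1 - d) * L * b)%R by rewrite ler_wpM2r.
suff : (s * N * B <= b * L + s * N * (C / (1 - d)))%R by lra.
rewrite -(ler_pM2l d1').
have -> : ((1 - d) * (b * L + s * N * (C / (1 - d))) = (1 - d) * L * b + s * N * C)%R.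
  by field; lra.
lra.
Qed.

(** * Points that hit every target at sparse times *)

Section cantor_set.
Context {R : realType} {A : finType}.
Variables (X Y : set (full_shift R A)) (N a : nat) (p : nat -> nat).
Variables (z : nat -> nat -> full_shift R A) (K : nat -> nat -> nat).
Variable T : nat -> nat -> Prop.
Hypotheses (Yc : compact Y) (Y0 : Y !=set0) (YX : Y `<=` X).
Hypotheses (XX : left_shift @` X `<=` X) (N0 : (0 < N)%N) (aN : (a < N)%N).
Hypothesis glue : forall bs : seq (full_shift R A * nat * nat),
  (forall b, b \in bs -> admissible Y p b) -> exists2 w, Y w & follows N bs w.
Hypothesis T_infinite : forall j B, exists2 n, (B <= n)%N & T j n.
Hypothesis T_center : forall j n, T j n -> exists y t i,
  [/\ Y y, (i < N)%N, (N * t + i = n + a)%N & z j n = iter i left_shift y].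

Definition hits : set (full_shift R A) := [set x | X x /\
  forall j B, exists n, [/\ (B <= n)%N, T j n & agree (K j n) (iter n left_shift x) (z j n)]].

(* Stage [k] shadows [y k] for [l k] blocks of [N] letters from time [N * t k]
   on; stage [0] is a dummy starting at time [0], and stage [k.+1] makes the
   orbit hit the target of index [logn 2 k.+1], which takes every value
   infinitely often, at time [n k]. *)
Lemma hitting_stages (D : nat) : (0 < D)%N ->
  exists (t l n : nat -> nat) (y : nat -> full_shift R A),
  [/\ t 0%N = 0%N, l 0%N = 1%N, forall k, (0 < l k)%N, forall k, Y (y k) &
      forall k, [/\ (D * (t k + l k + p (l k)) <= t k.+1)%N, (k <= n k)%N,
        T (logn 2 k.+1) (n k) &
        exists i, [/\ (i < N)%N, (N * t k.+1 + i = n k + a)%N,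
          z (logn 2 k.+1) (n k) = iter i left_shift (y k.+1) &
          l k.+1 = ((i + K (logn 2 k.+1) (n k)) %/ N).+1]]].
Proof.
move=> D0; have [y0 Yy0] := Y0.
have /choice[nx nxP] (kv : nat * nat) : exists s : nat * nat * nat * full_shift R A,
    [/\ (D * kv.2 <= s.1.1.2)%N, (kv.1 <= s.1.1.1)%N, T (logn 2 kv.1.+1) s.1.1.1 &
    [/\ Y s.2, (s.1.2 < N)%N, (N * s.1.1.2 + s.1.2 = s.1.1.1 + a)%N &
     z (logn 2 kv.1.+1) s.1.1.1 = iter s.1.2 left_shift s.2]].
  case: kv => k v /=.
  (* As [N * t] exceeds [n - N], the threshold forces [D * v <= t]; the summand [k] gives
     [k <= n]. *)
  have [n nB Tn] := T_infinite (logn 2 k.+1) (N * (D * v + 1) + k)%N.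
  have [y [t [i [Yy iN tn zn]]]] := T_center Tn.
  exists (n, t, i, y) => /=; split => //; last by apply: leq_trans nB; exact: leq_addl.
  rewrite -(leq_pmul2l N0); move: nB; rewrite mulnDr; lia.
pose v (s : nat * nat * full_shift R A) := (s.1.1 + s.1.2 + p s.1.2)%N.
pose nxt k s := let u := nx (k, v s) in
  (u.1.1.2, ((u.1.2 + K (logn 2 k.+1) u.1.1.1) %/ N).+1, u.2).
pose st := fix st k := if k is k'.+1 then nxt k' (st k') else (0%N, 1%N, y0).
exists (fun k => (st k).1.1), (fun k => (st k).1.2), (fun k => (nx (k, v (st k))).1.1.1),
  (fun k => (st k).2); split => //.
- by case.
- by case=> [|k] //=; have [_ _ _ []] := nxP (k, v (st k)).
- move=> k; have [Dv kn Tn [Yy iN tn zn]] := nxP (k, v (st k)); split => //.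
  by exists (nx (k, v (st k))).1.2.
Qed.

Section coding.
Variables (t l n : nat -> nat) (y : nat -> full_shift R A) (D : nat) (m : nat).
Hypotheses (D0 : (0 < D)%N) (m0 : (0 < m)%N).
Hypotheses (t0 : t 0%N = 0%N) (l00 : l 0%N = 1%N).
Hypotheses (l0 : forall k, (0 < l k)%N) (Yy : forall k, Y (y k)).
Hypothesis stage : forall k, [/\ (D * (t k + l k + p (l k)) <= t k.+1)%N, (k <= n k)%N,
        T (logn 2 k.+1) (n k) &
        exists i, [/\ (i < N)%N, (N * t k.+1 + i = n k + a)%N,
          z (logn 2 k.+1) (n k) = iter i left_shift (y k.+1) &
          l k.+1 = ((i + K (logn 2 k.+1) (n k)) %/ N).+1]].

(* Stage [k] proper, including its gap, ends at [v k]; the [r k] free words of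
   stage [k] have period [Q] and start at [u k], and [F k] of them precede the
   stage. *)
Let Q := (m + p m)%N.
Let v k := (t k + l k + p (l k))%N.
Let r k := ((t k.+1 - v k) %/ Q)%N.
Let u k := (t k.+1 - r k * Q)%N.
Let F k := (\sum_(i < k) r i)%N.

Let Q0 : (0 < Q)%N. Proof. by rewrite addn_gt0 m0. Qed.

Let vt k : (v k <= t k.+1)%N.
Proof. by have [Dv _ _ _] := stage k; apply: leq_trans Dv; rewrite leq_pmull. Qed.

Let rQ k : (v k + r k * Q <= t k.+1)%N.
Proof. by rewrite -leq_subRL// leq_trunc_div. Qed.

Let uE k : (u k + r k * Q = t k.+1)%N.
Proof. by rewrite /u subnK// (leq_trans _ (rQ k))// leq_addl. Qed.

Let vu k : (v k <= u k)%N.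
Proof. by rewrite -(leq_add2r (r k * Q)) uE rQ. Qed.

Let uv k : (u k < v k + Q)%N.
Proof.
have := ltn_ceil (t k.+1 - v k) Q0; rewrite -/(r k) mulSn => H.
by rewrite -(ltn_add2r (r k * Q)) uE -addnA -ltn_subLR.
Qed.

Let tv k : (t k < v k)%N.
Proof. by rewrite /v -addnA -[X in (X < _)%N]addn0 ltn_add2l addn_gt0 l0. Qed.

Let t_mono : {homo t : i j / (i <= j)%N}.
Proof. by apply: homo_leq => // i; [exact: leq_trans|rewrite ltnW// (leq_trans (tv i))]. Qed.

Lemma stage_of_time B : exists k, (t k <= B < t k.+1)%N.
Proof.
elim: B => [|B [k /andP[tB Bt]]].
  by exists 0%N; rewrite t0/= (leq_trans _ (vt 0))// (leq_trans _ (tv 0)).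
have [Bt'|Bt'] := ltnP B.+1 (t k.+1); first by exists k; rewrite ltnW.
exists k.+1; rewrite Bt'/=.
by rewrite (leq_ltn_trans Bt)// (leq_trans (tv _))// vt.
Qed.

Lemma stage_index k i : (i < F k)%N ->
  exists k' i', [/\ (k' < k)%N, (i' < r k')%N & i = (F k' + i')%N].
Proof.
rewrite /F; elim: k => [|k IH]; first by rewrite big_ord0.
rewrite big_ord_recr/= => ik.
have [ik'|ki] := ltnP i (\sum_(j < k) r j).
  by have [k' [i' [k'k ir ->]]] := IH ik'; exists k', i'; split => //; exact: ltnW.
by exists k, (i - \sum_(j < k) r j)%N; split => //; [rewrite ltn_subLR|rewrite subnKC].
Qed.

(** A sequence [c] of choices is written into the free words, at places independent of [c].
    Agreement of two points on [i] letters thus forces equal choices in all free words completed by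
    then, which [b] counts. The last clause bounds time by the number of choices. *)
Lemma coding (E : Type) (rep : E -> full_shift R A) :
  (forall e, Y (rep e)) ->
  (forall e e', agree (N * m) (rep e) (rep e') -> e = e') ->
  exists (x : (nat -> E) -> full_shift R A) (b : nat -> nat),
  [/\ forall c, hits (x c),
      forall c c' i, agree i (x c) (x c') -> agree (b (i %/ N)%N) c c' &
      forall B, exists k, [/\ (t k <= B)%N, (F k <= b B)%N & (B < v k + Q + Q * (b B - F k).+1)%N]].
Proof.
move=> Yrep rep_inj.
have /choice[w wP] (c : nat -> E) : exists w, Y w /\ forall k,
    agree (N * l k) (y k) (iter (N * t k) left_shift w) /\
    forall i, (i < r k)%N ->
      agree (N * m) (rep (c (F k + i)%N)) (iter (N * (u k + i * Q)) left_shift w).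
  have [w Yw wP] := staged_gluing (x := fun k i => rep (c (F k + i)%N)) Yc glue t0 m0 l0 vt Yy (fun k i => Yrep _).
  by exists w.
have /choice[k_ k_P] := stage_of_time.
(* Truncated subtraction makes the second term 0 before the free words of the stage begin. *)
pose b B := (F (k_ B) + (B - u (k_ B)) %/ Q)%N.
exists (fun c => iter a left_shift (w c)), b; split.
- move=> c; have [Yw {}wP] := wP c; split; first by apply: iter_left_shift_in => //; exact: YX.
  (* Since [k.+1] is 2^j times an odd number, stage [k.+1] serves target [j]; the odd factor makes
     [k] at least [B]. *)
  move=> j B; pose k := (2 ^ j * (B.*2.+1)).-1.
  have k1 : k.+1 = (2 ^ j * B.*2.+1)%N by rewrite prednK// muln_gt0 expn_gt0.
  have kj : logn 2 k.+1 = j.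
    rewrite k1 lognM ?expn_gt0// pfactorK// logn_coprime ?addn0//.
    by rewrite coprime2n /= odd_double.
  have Bk : (B <= k)%N.
    rewrite -ltnS k1 (@leq_trans (B.*2.+1))// ?leq_pmull ?expn_gt0//.
    by rewrite ltnS -addnn leq_addr.
  have [_ kn + [i [iN tn +]]] := stage k; rewrite kj => Tn zn lk.
  exists (n k); split => //; first exact: leq_trans kn.
  (* Time [n k] for the point shifted by [a] is time [N * t k.+1 + i] for [w c], and the [l k.+1]
     blocks cover [i + K j (n k)] letters. *)
  rewrite zn -iterD -tn addnC iterD.
  apply: agree_sym; have [yw _] := wP k.+1.
  apply: agree_iter_left_shift; apply: agreeW yw.
  by rewrite lk ltnW// mulnC ltn_ceil.
- move=> c c' i xx j jb.
  set B := (i %/ N)%N in jb.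
  have [k [q [jE qr qB]]] : exists k q, [/\ j = (F k + q)%N, (q < r k)%N & (u k + q * Q + m <= B)%N].
    have /andP[tB Bt] := k_P B.
    have [jF|Fj] := ltnP j (F (k_ B)).
      have [k' [q [kk qr jE]]] := stage_index jF; exists k', q; split => //.
      apply: leq_trans tB; apply: leq_trans (t_mono kk); rewrite -uE -addnA leq_add2l.
      apply: (@leq_trans (q.+1 * Q)); last by rewrite leq_mul2r qr orbT.
      by rewrite mulSn addnC leq_add2r leq_addr.
    have qb : (j - F (k_ B) < (B - u (k_ B)) %/ Q)%N by rewrite ltn_subLR.
    have qQ : ((j - F (k_ B)).+1 * Q <= B - u (k_ B))%N.
      by apply: leq_trans (leq_trunc_div _ Q); rewrite leq_mul2r qb orbT.
    have uB : (u (k_ B) <= B)%N.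
      by rewrite leqNgt; apply/negP => Bu; move: qb; rewrite (eqP (ltnW Bu)) div0n.
    exists (k_ B), (j - F (k_ B))%N; split; first by rewrite subnKC.
      rewrite -(ltn_pmul2r Q0) -(ltn_add2l (u (k_ B))) uE; apply: leq_ltn_trans Bt.
      by rewrite -leq_subRL// (leq_trans _ qQ)// leq_mul2r leqnSn orbT.
    rewrite -addnA -leq_subRL// (leq_trans _ qQ)// mulSn addnC leq_add2r.
    exact: leq_addr.
  rewrite jE; apply: rep_inj.
  have [_ /(_ k)[_ /(_ q qr) cw]] := wP c; have [_ /(_ k)[_ /(_ q qr) cw']] := wP c'.
  apply: agree_trans cw _; apply: agree_trans (agree_sym cw').
  (* No free word starts within the first [a] letters, which the shift erases. *)
  have aB : (a <= N * (u k + q * Q))%N.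
    apply: leq_trans (ltnW aN) _; rewrite leq_pmulr// addn_gt0.
    by rewrite (leq_trans _ (vu k))// (leq_trans _ (tv k)).
  rewrite -(subnK aB) !iterD; apply: agree_iter_left_shift; apply: agreeW xx.
  apply: (@leq_trans (N * (u k + q * Q + m))); first by rewrite [leqRHS]mulnDr leq_add2r leq_subr.
  by apply: (@leq_trans (N * B)); [rewrite leq_mul2l qB orbT|rewrite mulnC leq_trunc_div].
- move=> B; exists (k_ B); have /andP[tB Bt] := k_P B; split => //; first exact: leq_addr.
  rewrite /b addKn; have := ltn_ceil (B - u (k_ B)) Q0; have := uv (k_ B).
  by rewrite [(_.+1 * Q)%N]mulnC; lia.
Qed.

Section rate.
Variables beta delta Cp : R.
Hypotheses (beta0 : (0 <= beta)%R) (delta01 : (0 < delta < 1)%R) (Cp0 : (0 <= Cp)%R).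
Hypothesis K_rate : forall j i, T j i -> ((K j i)%:R <= beta * i%:R + 1)%R.
Hypothesis p_rate : forall i, ((p i)%:R <= delta * i%:R + Cp)%R.
Hypothesis D_rate : (1 <= delta * D%:R)%R.

Let t_bound k : ((1 - delta) * (t k)%:R <= Q%:R * ((F k)%:R + 1))%R.
Proof.
case: k => [|k]; first by rewrite t0 mulr0 mulr_ge0// addr_ge0.
have [Dv _ _ _] := stage k.
rewrite /F big_ord_recr/= natrD; apply: (@stage_end_bound _ _ D%:R (v k)%:R) => //.
- by case/andP: delta01.
- by rewrite -natrM ler_nat.
- by rewrite -natrM -!natrD ler_nat -uE leq_add2r ltnW.
Qed.

(** The summand [1 + p 1] covers the dummy stage, of length 1 and gap [p 1]. *)
Let C2 : R := ((1 + delta) * (beta + 3) + Cp + (1 + p 1)%:R)%R.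

Let v_bound k : ((v k)%:R <= (1 + beta) * (1 + delta) * (t k)%:R + C2)%R.
Proof.
have /andP[d0 d1] := delta01.
case: k => [|k].
  rewrite /v t0 l00 mulr0 add0r add0n /C2 lerDr addr_ge0// mulr_ge0// addr_ge0//.
  exact: ltW.
have [_ _ /K_rate Kn [i [iN tn _ lE]]] := stage k.
apply: (@le_trans _ _ ((1 + beta) * (1 + delta) * (t k.+1)%:R + ((1 + delta) * (beta + 3) + Cp))%R); last first.
  by rewrite lerD2l /C2 lerDl.
rewrite /v !natrD; apply: target_end_bound => //.
apply: (@target_length_bound _ _ N%:R _ _ _ _ beta0 _ _ _ Kn); first by rewrite ler1n.
- rewrite -natrM -!natrD ler_nat lE mulSn addnC leq_add2r.
  by apply: leq_trans (leq_trunc_div _ _) _; rewrite leq_add2r ltnW.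
- by rewrite -natrM -natrD ler_nat (leq_trans (leq_addr a _))// -tn leq_add2l ltnW.
Qed.

(** Asymptotically a choice takes at most (1 + beta)(1 + delta) Q / (1 - delta) units of time, a
    unit being [N] letters. *)
Lemma coding_rate : exists C : R, forall B k b, (t k <= B)%N -> (F k <= b)%N ->
  (B < v k + Q + Q * (b - F k).+1)%N ->
  ((1 - delta) * B%:R <= (1 + beta) * (1 + delta) * Q%:R * b%:R + C)%R.
Proof.
have /andP[d0 d1] := delta01.
exists ((1 + beta) * (1 + delta) * Q%:R + C2 + 2 * Q%:R)%R => B k b tB Fb.
rewrite -(ltr_nat R) natrD natrD natrM -natr1 natrB// => /ltW BR.
apply: time_bound BR => //.
- by rewrite mulr_ege1// lerDl// ltW.
- by rewrite /C2 !addr_ge0// mulr_ge0// addr_ge0// ltW.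
- by rewrite ler_nat.
Qed.

End rate.
End coding.

Lemma hits_nonempty : hits !=set0.
Proof.
have [t [l [n [y [t0 l00 l0 Yy stage]]]]] := hitting_stages (D := 1) isT.
have [y0 Yy0] := Y0.
(* A one-letter alphabet of choices suffices to produce a single point. *)
have [||x [b [xh _ _]]] := @coding t l n y 1 1 isT isT t0 l00 l0 Yy stage unit (fun=> y0).
- by [].
- by do 2 case.
by exists (x (fun=> tt)).
Qed.

(** A cheap cover of [hits] pulls back along the coding to a cover of the sequences over [E] by
    pieces on which the first choices are constant. The rates make its total weight less than 1,
    against the Kraft inequality. *)
Lemma hits_not_thin (beta s : R) :
  X `<=` \bigcup_(i < N) (iter i left_shift @` Y) ->
  limn_esup (fun n => ((p n)%:R / n%:R)%:E : \bar R) = 0 ->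
  (0 <= beta)%R -> (forall j i, T j i -> (K j i)%:R <= beta * i%:R + 1)%R ->
  (0 <= s)%R -> (s * (1 + beta) < growth X)%R -> ~ thin hits s.
Proof.
move=> XY p_lim beta0 K_rate s0 sh hits_thin.
have X0 : X !=set0 by case: Y0 => y0 /YX; exists y0.
have [d d01 dh] := exists_slack (mulr_ge0 s0 (addr_ge0 ler01 beta0)) sh.
have /andP[d0 d1] := d01.
have [Cp Cp0 p_rate] := sublinear_affine p_lim d0.
have [n0 pn0] := sublinear_le p_lim d0.
pose D := (Num.truncn d^-1).+1.
have D_rate : (1 <= d * D%:R)%R.
  by rewrite -ler_pdivrMl// mulr1 ltW// truncnS_gt.
pose h := growth X; have h0 : (0 <= h)%R by exact: growth_ge0.
pose gap := (h * (1 - d) - s * (1 + beta) * ((1 + d) * (1 + d)))%R.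
have gap0 : (0 < gap)%R by rewrite subr_gt0.
pose G := (N%:R * h + ln N%:R)%R.
have N1 : (1 <= N%:R :> R)%R by rewrite ler1n.
have G0 : (0 <= G)%R by rewrite addr_ge0 ?mulr_ge0// ln_ge0.
pose m' := maxn n0 (Num.truncn (G / gap)); pose m := m'.+1.
have mG : (G <= m%:R * gap)%R.
  rewrite -ler_pdivrMr// (le_trans (ltW (truncnS_gt _)))// ler_nat ltnS.
  exact: leq_maxr.
pose Q := (m + p m)%N.
have Qm : (Q%:R <= m%:R * (1 + d) :> R)%R.
  have := pn0 m (leq_trans (leq_maxl _ _) (leqnSn _)); rewrite /Q natrD.
  by rewrite mulrDr mulr1 lerD2l mulrC.
pose E : finType := {w : (N * m).-tuple A | w \in lang Y (N * m)}.
have /choice[rep repP] (e : E) : exists y, Y y /\ word (N * m) y = val e.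
  by case: e => w /= /langP[y Yy yw]; exists y.
have rep_inj e e' : agree (N * m) (rep e) (rep e') -> e = e'.
  by move=> /wordP; rewrite (repP e).2 (repP e').2 => /val_inj.
have [y0 Yy0] := Y0.
have y0E : word (N * m) y0 \in lang Y (N * m) by apply/langP; exists y0.
pose e0 : E := exist (fun w => w \in lang Y (N * m)) _ y0E.
pose M : R := #|E|%:R.
have ME : M = #|lang Y (N * m)|%:R by rewrite /M card_sig.
have M0 : (0 < M)%R by rewrite ltr0n; apply/card_gt0P; exists e0.
(* Words of [X] of length [N * m'] number at most [N] times the words of [Y] of length [N * m],
   whose [N] extra letters make room for the offset. *)
have lnM : (N%:R * m'%:R * h <= ln N%:R + ln M)%R.
  rewrite -lnM ?posrE ?(lt_le_trans _ N1)// -[leLHS]expRK ler_ln ?posrE ?expR_gt0//; last first.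
    by rewrite mulr_gt0// (lt_le_trans _ N1).
  rewrite -[(N%:R * m'%:R)%R]natrM; apply: le_trans (growth_lb X0 _) _.
  by rewrite ME -natrM ler_nat (leq_trans (card_lang_bigcup _ Y0 XY))// -mulnSr.
have [t [l [n [y [t0 l00 l0 Yy stage]]]]] := hitting_stages (D := D) isT.
have [x [b [xh xb bP]]] :=
  @coding t l n y D m isT isT t0 l00 l0 Yy stage E rep (fun e => (repP e).1) rep_inj.
have [C CP] :=
  @coding_rate t l n y D m isT isT t0 l00 stage beta d Cp beta0 d01 Cp0 K_rate p_rate D_rate.
have ML : (s * N%:R * ((1 + beta) * (1 + d) * Q%:R) <= (1 - d) * ln M)%R.
  rewrite /m -natr1 in mG Qm.
  exact: (@alphabet_rate _ _ _ _ h _ m'%:R _ (ln N%:R)).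
pose c := (s * N%:R * (C / (1 - d)) + s * N%:R)%R.
have b_rate i : (s * i%:R <= (b (i %/ N)%N)%:R * ln M + c)%R.
  have [k [tB Fb Bb]] := bP (i %/ N)%N.
  have := CP _ _ _ tB Fb Bb; rewrite -/Q.
  have : (i%:R <= N%:R * (i %/ N)%:R + N%:R :> R)%R.
    by rewrite -natrM -natrD ler_nat -mulnSr mulnC ltnW// ltn_ceil.
  by move=> iB BC; apply: (cost_rate s0 d01 _ _ ML BC iB).
(* This tolerance cancels the constant of [b_rate] and leaves total weight at most 1/2. *)
have [DD [U [nn [DU ZU cost]]]] := hits_thin 0%N (expR (- c) / 2)%R (divr_gt0 (expR_gt0 _) (ltr0Sn _ 1)).
have := @cylinder_cover_ge1 R E e0 DD (fun i => [set e | U i (x e)]) (fun i => b (nn i %/ N)%N).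
rewrite -/M => cover_ge1.
have : 1 <= \esum_(i in DD) (M ^- b (nn i %/ N)%N)%:E.
  apply: cover_ge1 => [i e e' Di Ue Ue'|e]; last by have [i Di Ui] := ZU _ (xh e); exists i.
  by apply: xb; apply: (DU i Di).2.
apply/negP; rewrite -ltNge.
apply: (@le_lt_trans _ _ (\esum_(i in DD) ((expR c)%:E * (expR (- s * (nn i)%:R))%:E))).
  apply: le_esum => i _; rewrite -EFinM lee_fin -expRD.
  rewrite -[M in leLHS]lnK// -expRM_natl -expRN ler_expR.
  have := b_rate (nn i); move: (b _)%:R => bb; lra.
apply: le_lt_trans (esumZ_le _ (expR_ge0 _) _) _; first by move=> i; rewrite lee_fin expR_ge0.
apply: le_lt_trans (lee_pmul _ _ (lexx _) cost) _.
- by rewrite lee_fin expR_ge0.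
- exact: esum_cost_ge0.
rewrite -EFinM lte_fin mulrA -expRD subrr expR0; lra.
Qed.

End cantor_set.

(** * The theorem *)

Lemma exists_EFin_between (R : realType) (x y : \bar R) :
  x < y -> exists r : R, x < r%:E /\ r%:E < y.
Proof.
case: x y => [x||] [y||]//; rewrite ?lte_fin => xy.
- by exists ((x + y) / 2)%R; rewrite !lte_fin; split; lra.
- by exists (x + 1)%R; rewrite lte_fin ltry; split => //; lra.
- by exists (y - 1)%R; rewrite lte_fin ltNyr; split => //; lra.
- by exists 0%R; rewrite ltNyr ltry.
Qed.

Lemma inve_scale_lt (R : realType) (t : \bar R) (h s : R) : 0 <= t -> (0 <= h)%R ->
  (1 + t)^-1 * h%:E < s%:E -> (0 < s)%R /\ (h / s - 1)%:E < t.
Proof.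
move=> t0 h0; case: t t0 => [t||]// t0.
  rewrite lee_fin in t0; have t1 : (0 < 1 + t)%R by lra.
  rewrite -EFinD inver gt_eqF// -EFinM lte_fin ltr_pdivrMl// => hs.
  have s0 : (0 < s)%R by rewrite -(pmulr_rgt0 _ t1); exact: le_lt_trans hs.
  by split => //; rewrite lte_fin ltrBlDl ltr_pdivrMr.
by rewrite addey// invey mul0e lte_fin => s0; split => //; rewrite ltry.
Qed.

Lemma lt_inve_scale (R : realType) (t : \bar R) (h s : R) : 0 <= t -> (0 <= s)%R ->
  s%:E < (1 + t)^-1 * h%:E -> exists2 r : R, t = r%:E & (s * (1 + r) < h)%R.
Proof.
move=> t0 s0; case: t t0 => [t||]// t0.
  rewrite lee_fin in t0; have t1 : (0 < 1 + t)%R by lra.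
  rewrite -EFinD inver gt_eqF// -EFinM lte_fin ltr_pdivlMl// => hs.
  by exists t => //; rewrite mulrC.
by rewrite addey// invey mul0e lte_fin ltNge s0.
Qed.

Lemma infinite_setNP (S : set nat) :
  infinite_set S <-> forall m, exists2 n, (m <= n)%N & S n.
Proof.
split=> [Soo m|SP Sf].
  apply: contrapT => H; apply: Soo; apply: (sub_finite_set _ (finite_II m)) => n Sn /=.
  by rewrite ltnNge; apply/negP => mn; apply: H; exists n.
have [m mP] : exists m, forall n, S n -> (n <= m)%N.
  have /finite_fsetP[X SX] := Sf.
  exists (\max_(i <- finmap.enum_fset X) i)%N => n; rewrite SX /= => nX.
  exact: (@leq_bigmax_seq _ _ predT id).
by have [n + /mP] := SP m.+1; rewrite ltnNge => /negP.
Qed.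

(** * Bounds for the shrinking target sets *)

Section targets.
Context {R : realType} {A : finType}.
Variables (X : set (full_shift R A)) (phi : nat -> nat -> R) (z : nat -> nat -> full_shift R A).
Hypotheses (X0 : X !=set0) (XX : left_shift @` X `<=` X).
Hypothesis phi01 : forall j n, (0 < phi j n <= 1)%R.

Local Notation Sinf S := (\bigcap_j shrinking_target X left_shift (phi j) (z j) (S j)).

Let phi0 j n : (0 < phi j n)%R. Proof. by case/andP: (phi01 j n). Qed.

Let lnphi j n : (0 <= - ln (phi j n))%R.
Proof. by rewrite oppr_ge0 ln_le0//; case/andP: (phi01 j n). Qed.

Lemma decay_rate_ge0 j n : 0 <= decay_rate (phi j) n.
Proof. by rewrite lee_fin divr_ge0. Qed.

Lemma lower_tau_ge0 : 0 <= lower_tau phi.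
Proof.
apply: (@le_trans _ _ (limn_einf (decay_rate (phi 0%N)))); last first.
  by apply: ereal_sup_ubound; exists 0%N.
rewrite leNgt; apply/negP => /limn_einf_lt/(_ 0%N)[n _].
by apply/negP; rewrite -leNgt decay_rate_ge0.
Qed.

Lemma upper_tau_ge0 : 0 <= upper_tau phi.
Proof.
apply: (@le_trans _ _ (limn_esup (decay_rate (phi 0%N)))); last first.
  by apply: ereal_sup_ubound; exists 0%N.
apply: le_trans (limn_einf_sup _); rewrite leNgt; apply/negP => /limn_einf_lt/(_ 0%N)[n _].
by apply/negP; rewrite -leNgt decay_rate_ge0.
Qed.

Lemma thin_dim_le_of_thin (Z : set (full_shift R A)) (x : \bar R) : 0 <= x ->
  (forall s : R, x < s%:E -> thin Z s) -> thin_dim Z <= x.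
Proof.
move=> x0 H; rewrite leNgt; apply/negP => /exists_EFin_between[s [xs]].
apply/negP; rewrite -leNgt; apply: ereal_inf_lbound; exists s => //; split; last exact: H.
by rewrite -lee_fin ltW// (le_lt_trans x0).
Qed.

Lemma thin_dimS (Z Z' : set (full_shift R A)) : Z `<=` Z' -> thin_dim Z <= thin_dim Z'.
Proof.
move=> ZZ'; apply: le_ereal_inf_tmp => _ [s [s0 Zs] <-]; apply: ereal_inf_lbound.
by exists s => //; split => //; exact: thinS Zs.
Qed.

(** With [K = 0] every point hits at every time, so the upper bound with rate 0 applies to [X]
    itself. *)
Lemma thin_dim_le_growth : thin_dim X <= (growth X)%:E.
Proof.
apply: thin_dim_le_of_thin => [|s]; rewrite ?lee_fin ?growth_ge0// lte_fin => gs.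
have s0 : (0 <= s)%R by rewrite ltW// (le_lt_trans (growth_ge0 X0)).
have [x0 _] := X0.
apply: (@limsup_thin _ _ X X (fun=> x0) (fun=> 0%N) X0 XX _ _ s 0%R 0%N) => //.
- by move=> x _ m; exists m.
- by move=> n _; rewrite mulr0 sub0r lerNl oppr0.
- by rewrite addr0 mulr1.
Qed.

(** One target suffices, chosen with lower rate above [growth X / s - 1]. Here [- ln (phi j n)] is
    rounded down, so that proximity implies agreement. *)
Lemma thin_dim_targets_le (S : nat -> set nat) :
  thin_dim (Sinf S) <= (1 + lower_tau phi)^-1 * (growth X)%:E.
Proof.
have t0 := lower_tau_ge0; have g0 := growth_ge0 X0.
apply: thin_dim_le_of_thin.
  by rewrite mule_ge0 ?inve_ge0 ?adde_ge0 ?lee_fin.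
move=> s /(inve_scale_lt t0 g0)[s0] /ereal_sup_gt[_ [j _ <-]].
move=> /exists_EFin_between[r [gr /lt_limn_einf[n0 n0P]]].
apply: (@limsup_thin _ _ X _ (z j) (fun n => Num.truncn (- ln (phi j n))) X0 XX _ _ s r n0.+1).
- by move=> x /(_ j I)[].
- move=> x /(_ j I)[_ /infinite_setNP xS] m; have [n mn [_ xn]] := xS m.
  exists n => //; apply: (@agree_mdist R); apply: lt_le_trans xn _.
  have /andP[tr _] := truncn_itv (lnphi j n).
  by rewrite -[leLHS]lnK ?posrE// ler_expR lerNr.
- exact: ltW.
- move=> n n0n; have := n0P n (ltnW n0n); rewrite lte_fin ltr_pdivlMr ?ltr0n ?(leq_trans _ n0n)//.
  have /andP[_] := truncn_itv (lnphi j n); rewrite -natr1; lra.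
- move: gr; rewrite lte_fin ltrBlDl ltr_pdivrMr// mulrC; lra.
Qed.

Variables (Y : set (full_shift R A)) (N : nat).
Hypotheses (Y0 : Y !=set0) (Yc : compact Y) (YX : Y `<=` X) (N0 : (0 < N)%N).
Hypothesis XY : X `<=` \bigcup_(i < N) (iter i left_shift @` Y).
Hypothesis Yspec : nonuniform_specification Y (iter N left_shift).

(** If a point follows [y] from time [N * t] on, its shift by [a] is near [z j n] at time [n]. *)
Definition shadowable a j n := exists y t i,
  [/\ Y y, (i < N)%N, (N * t + i = n + a)%N & z j n = iter i left_shift y].

(** Rounded up, so that agreement on this many letters implies proximity. *)
Let K j n := (Num.truncn (- ln (phi j n))).+1.

Lemma hits_targets (S : nat -> set nat) (T : nat -> nat -> Prop) :
  (forall j n, T j n -> S j n) -> hits X z K T `<=` Sinf S.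
Proof.
move=> TS x [Xx xT] j _; split => //; apply/infinite_setNP => m.
have [n [mn Tn xn]] := xT j m; exists n => //; split; first exact: TS.
apply: lt_le_trans (mdist_agree_lt xn) _.
by rewrite -[leRHS]lnK ?posrE// ler_expR lerNl ltW// truncnS_gt.
Qed.

Lemma targets_nonempty (S : nat -> set nat) a : (a < N)%N ->
  (forall j B, exists2 n, (B <= n)%N & S j n /\ shadowable a j n) -> Sinf S !=set0.
Proof.
move=> aN ST; have [p _ glue] := specification_follows Y0 Yspec.
have [|x xh] := @hits_nonempty _ _ X Y N a p z K (fun j n => S j n /\ shadowable a j n)
  Yc Y0 YX XX N0 aN glue ST.
  by move=> j n [].
by exists x; apply: hits_targets xh => j n [].
Qed.

(** Keeping [tau] a parameter serves two cases: with [upper_tau] all late times have rate below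
    [beta], while [lower_tau] suffices when hitting times can be chosen freely. *)
Lemma thin_dim_targets_ge (S : nat -> set nat) a (tau : \bar R) : (a < N)%N -> 0 <= tau ->
  (forall beta : R, tau < beta%:E -> forall j B, exists2 n, (B <= n)%N &
     [/\ S j n, shadowable a j n & decay_rate (phi j) n < beta%:E]) ->
  (1 + tau)^-1 * (growth X)%:E <= thin_dim (Sinf S).
Proof.
move=> aN t0 ST; have [p plim glue] := specification_follows Y0 Yspec.
apply: le_ereal_inf_tmp => _ [s [s0 Ss] <-]; rewrite leNgt; apply/negP.
move=> /(lt_inve_scale t0 s0)[r tr sr].
rewrite tr lee_fin in t0.
(* For positive [s], [beta] is the midpoint of [r] and [growth X / s - 1]; for [s = 0] any value
   above [r] works. *)
have [beta rb sb] : exists2 beta : R, (r < beta)%R & (s * (1 + beta) < growth X)%R.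
  have [s00|sn0] := eqVneq s 0%R.
    by exists (r + 1)%R; [lra|move: sr; rewrite s00 !mul0r].
  have sp : (0 < s)%R by rewrite lt_neqAle eq_sym sn0.
  exists ((r + (growth X / s - 1)) / 2)%R.
    have : (r < growth X / s - 1)%R by rewrite ltrBrDl ltr_pdivlMr// mulrC.
    lra.
  have -> : (s * (1 + (r + (growth X / s - 1)) / 2) = (s * (1 + r) + growth X) / 2)%R.
    by field.
  lra.
have rbE : tau < beta%:E by rewrite tr lte_fin.
(* Time 0 is discarded because [decay_rate] divides by [n]. *)
pose T j n := [/\ S j n, (0 < n)%N, shadowable a j n & decay_rate (phi j) n < beta%:E].
have Too j B : exists2 n, (B <= n)%N & T j n.
  have [n Bn [Sn shn dn]] := ST beta rbE j B.+1.
  by exists n; [exact: ltnW|split => //; exact: leq_trans Bn].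
have Tc j n : T j n -> shadowable a j n by case.
apply: (@hits_not_thin _ _ X Y N a p z K T Yc Y0 YX XX N0 aN glue Too Tc beta s) => //.
- by rewrite (le_trans t0)// ltW.
- move=> j n [_ n0 _]; rewrite lte_fin ltr_pdivrMr ?ltr0n// => dn.
  have /andP[tn _] := truncn_itv (lnphi j n).
  by rewrite /K -natr1 lerD2r (le_trans tn)// ltW.
- by apply: thinS Ss; apply: hits_targets => j n [].
Qed.

End targets.

(** The lower bound comes from targets of constant radius 1, whose rate is 0. *)
Lemma thin_dim_growth (R : realType) (A : finType) (X Y : set (full_shift R A)) N :
  left_shift @` X `<=` X -> Y !=set0 -> compact Y -> Y `<=` X -> (0 < N)%N ->
  X `<=` \bigcup_(i < N) (iter i left_shift @` Y) ->
  nonuniform_specification Y (iter N left_shift) ->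
  thin_dim X = (growth X)%:E.
Proof.
move=> XX Y0 Yc YX N0 XY Yspec.
have X0 : X !=set0 by case: Y0 => y0 /YX; exists y0.
apply/eqP; rewrite eq_le thin_dim_le_growth//=.
have [y0 Yy0] := Y0.
have one01 (j n : nat) : (0 < (1 : R) <= 1)%R by rewrite ltr01 lexx.
apply: (@le_trans _ _ (thin_dim (\bigcap_(j in [set: nat]) shrinking_target X left_shift (fun=> 1%R)
   (fun=> y0) [set: nat]))); last first.
  by apply: thin_dimS => x /(_ 0%N I)[].
have := @thin_dim_targets_ge _ _ X (fun _ _ => 1%R) (fun _ _ => y0) XX one01 Y N
  Y0 Yc YX N0 XY Yspec (fun=> [set: nat]) 0%N 0 N0 (lexx _).
rewrite adde0 inve1 mul1e; apply => beta b0 j B.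
exists (N * B)%N; first by rewrite leq_pmull.
split => //; first by exists y0, B, 0%N.
by rewrite /decay_rate ln1 oppr0 mul0r.
Qed.

(** Let [c] be a common difference. Modulo [N], a hitting time plus [c] equals [i1], where the
    centre lies in the [i1]-th image of [Y]. Hence the residue [a] of [c] is an offset valid for
    every target. *)
Lemma Ind'_shadowable (R : realType) (A : finType) (Y : set (full_shift R A)) N
    (z : nat -> nat -> full_shift R A) (s : nat -> nat -> nat) :
  (0 < N)%N -> (forall j, s j @ \oo --> \oo) ->
  \bigcap_j Ind' left_shift N (z j) (s j) Y !=set0 ->
  exists2 a, (a < N)%N & forall j B, exists2 n, (B <= n)%N &
    range (s j) n /\ shadowable z Y N a j n.
Proof.
move=> N0 soo [c cP].
have Nn0 : N%:Z != 0%R by rewrite eqz_nat -lt0n.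
exists `|(c %% N%:Z)%Z|%N.
  by rewrite -ltz_nat gez0_abs ?modz_ge0// ltz_pmod.
move=> j B; have [[i1 i2] [/= i1N i2N ioo] cE] := cP j I.
(* Times at least [N] exceed [i1], which makes the quotient [k - q] nonnegative. *)
have [n0 _ n0P] := soo j _ (nbhs_infty_ge (maxn B N)).
have [i ni [[y Yy yz] /dvdzP[k kE]]] := (infinite_setNP _).1 ioo n0.
have := n0P i ni; rewrite /= geq_max => /andP[Bs Ns].
exists (s j i) => //; split; first by exists i.
have aE := gez0_abs (modz_ge0 c Nn0).
have cE' := divz_eq c N%:Z.
move: (absz _) aE => a aE; move: (divz _ _) cE' => q cE'.
have nE : ((s j i)%:Z + a%:Z - i1%:Z = (k - q) * N%:Z)%R.
  by rewrite aE mulrBl -kE; move: cE cE'; lia.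
have kq0 : (0 <= k - q)%R.
  by rewrite -(pmulr_lge0 _ (_ : 0 < N%:Z)%R)// -nE; lia.
exists y, `|k - q|%N, i1; split => //.
apply/eqP; rewrite -eqz_nat PoszD PoszM gez0_abs// mulrC -nE PoszD; apply/eqP; lia.
Qed.

Theorem theorem1p19 (R : realType) (A : finType) (X Y : set (full_shift R A))
    (N : nat) (phi : nat -> nat -> R) (z : nat -> nat -> full_shift R A) :
  is_subshift X ->
  (exists x y, [/\ X x, X y & x <> y]) ->
  Y !=set0 -> compact Y -> Y `<=` X ->
  (0 < N)%N ->
  iter N left_shift @` Y = Y ->
  X = \bigcup_(l < N) (iter l left_shift @` Y) ->
  nonuniform_specification Y (iter N left_shift) ->
  (forall j n, (0 < phi j n <= 1)%R) ->
  (forall j i, X (z j i)) ->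
  (forall s : nat -> nat -> nat,
    (forall j i, (0 < s j i)%N) ->
    (forall j, s j @ \oo --> \oo) ->
    \bigcap_j Ind' left_shift N (z j) (s j) Y !=set0 ->
    let Sinf := \bigcap_j shrinking_target X left_shift (phi j) (z j) (range (s j)) in
    [/\ Sinf !=set0,
        (1 + upper_tau phi)^-1 * htop X left_shift X <= htop X left_shift Sinf,
        htop X left_shift Sinf <= (1 + lower_tau phi)^-1 * htop X left_shift X,
        (1 + upper_tau phi)^-1 * htop X left_shift X <= hausdorff_dim Sinf &
        hausdorff_dim Sinf <= (1 + lower_tau phi)^-1 * htop X left_shift X]) /\
  (Y = X -> N = 1%N ->
    let Sinf := \bigcap_j shrinking_target X left_shift (phi j) (z j) [set: nat] in
    htop X left_shift Sinf = (1 + lower_tau phi)^-1 * htop X left_shift X /\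
    hausdorff_dim Sinf = (1 + lower_tau phi)^-1 * htop X left_shift X).
Proof.
move=> [_ XX] _ Y0 Yc YX N0 _ XE Yspec phi01 Xz.
have XY : X `<=` \bigcup_(l < N) (iter l left_shift @` Y) by rewrite -XE.
have X0 : X !=set0 by case: Y0 => y0 /YX; exists y0.
have hX : htop X left_shift X = (growth X)%:E.
  by rewrite (htopE (@subset_refl _ X) X0); exact: thin_dim_growth XY Yspec.
rewrite hX; split.
  move=> s _ soo /(Ind'_shadowable N0 soo)[a aN sh] Sinf.
  have SX : Sinf `<=` X by move=> x /(_ 0%N I)[].
  have S0 : Sinf !=set0.
    exact: (@targets_nonempty _ _ _ phi z XX phi01 Y N Y0 Yc YX N0 Yspec (fun j => range (s j)) a).
  rewrite hausdorff_dimE htopE//.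
  have ub : thin_dim Sinf <= (1 + lower_tau phi)^-1 * (growth X)%:E.
    exact: thin_dim_targets_le.
  suff lb : (1 + upper_tau phi)^-1 * (growth X)%:E <= thin_dim Sinf by [].
  apply: (@thin_dim_targets_ge _ _ _ phi z XX phi01 Y N Y0 Yc YX N0 XY Yspec (fun j => range (s j)) a) => //.
    exact: upper_tau_ge0.
  move=> beta taub j B.
  have [n0 n0P] : exists n0, forall n, (n0 <= n)%N -> decay_rate (phi j) n < beta%:E.
    apply: limn_esup_lt; apply: le_lt_trans taub.
    by apply: ereal_sup_ubound; exists j.
  have [n Bn [Sn shn]] := sh j (maxn B n0).
  move: Bn; rewrite geq_max => /andP[Bn n0n].
  by exists n => //; split => //; exact: n0P.
move=> YE N1 Sinf.
have SX : Sinf `<=` X by move=> x /(_ 0%N I)[].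
(* Every time is shadowable with offset 0, so hitting times may be picked along the lower limit. *)
have sh j n : shadowable z Y N 0 j n.
  by exists (z j n), n, 0%N; split => //; [rewrite YE|rewrite N1 mul1n].
have S0 : Sinf !=set0.
  apply: (@targets_nonempty _ _ _ phi z XX phi01 Y N Y0 Yc YX N0 Yspec (fun=> [set: nat]) 0%N) => //.
  by move=> j B; exists B.
rewrite hausdorff_dimE htopE//; suff -> : thin_dim Sinf = (1 + lower_tau phi)^-1 * (growth X)%:E by [].
apply/eqP; rewrite eq_le; apply/andP; split; first exact: thin_dim_targets_le.
apply: (@thin_dim_targets_ge _ _ _ phi z XX phi01 Y N Y0 Yc YX N0 XY Yspec (fun=> [set: nat]) 0%N) => //.
  exact: lower_tau_ge0.
move=> beta taub j B.
have [|n Bn dn] := @limn_einf_lt R (decay_rate (phi j)) beta%:E _ B.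
  by apply: le_lt_trans taub; apply: ereal_sup_ubound; exists j.
by exists n.
Qed.
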